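(* Let $\Lambda$ be an Iwanaga-Gorenstein artin algebra and let $\mathcal{C}$ be an $n\mathbb{Z}$-cluster tilting subcategory of $\mathrm{mod}\text{-}\Lambda$. Then: (1) The subcategory $n\mathbb{Z}\text{-}\mathrm{Gprj}\text{-}\mathcal{C}$ is an $n\mathbb{Z}$-cluster tilting subcategory of the exact category $\mathrm{Gprj}\text{-}\Lambda$. (2) The subcategory $\underline{n\mathbb{Z}\text{-}\mathrm{Gprj}\text{-}\mathcal{C}}$ is an $n\mathbb{Z}$-cluster tilting subcategory of the triangulated category $\underline{\mathrm{Gprj}\text{-}\Lambda}$.
   Context: $n$ is a positive integer, $R$ is a commutative artinian ring, $\Lambda$ is an artin $R$-algebra, $\mathrm{mod}\text{-}\Lambda$ is the category of finitely generated right $\Lambda$-modules, $\mathrm{prj}\text{-}\Lambda$ its full subcategory of projectives. $\Lambda$ is Iwanaga-Gorenstein if it has finite injective dimension both as a right and as a left module over itself. A full subcategory $\mathcal{C}$ of $\mathrm{mod}\text{-}\Lambda$ is $n$-cluster tilting if it is functorially finite and $\mathcal{C}=\{X\mid \mathrm{Ext}^i_\Lambda(\mathcal{C},X)=0 \text{ for all } 0<i<n\}=\{X\mid \mathrm{Ext}^i_\Lambda(X,\mathcal{C})=0\text{ for all } 0<i<n\}$. It is $n\mathbb{Z}$-cluster tilting if moreover $\mathrm{Ext}^i_\Lambda(\mathcal{C},\mathcal{C})=0$ for all $i>0$ with $i\notin n\mathbb{Z}$ (equivalently $\Omega^n(\mathcal{C})\subseteq\mathcal{C}$; equivalently $\Omega^{-n}(\mathcal{C})\subseteq\mathcal{C}$).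 An acyclic complex $\mathbf{P}:\cdots\to P^{-1}\to P^0\to P^1\to\cdots$ of finitely generated projective $\Lambda$-modules, with $Z^j=\mathrm{Ker}(P^j\to P^{j+1})$, is called $n\mathbb{Z}$-totally acyclic if (i) for every $i\in\mathbb{Z}$ and every projective $\Lambda$-module $Q$, applying $\mathrm{Hom}_\Lambda(-,Q)$ to the exact sequence $0\to Z^{in}\to P^{in}\to P^{in+1}\to\cdots\to P^{(i+1)n-1}\to Z^{(i+1)n}\to 0$ gives an acyclic complex, and (ii) $Z^{in}\in\mathcal{C}$ for all $i\in\mathbb{Z}$. A module $G\in\mathcal{C}$ is $n\mathbb{Z}$-Gorenstein projective if $G\cong Z^{in}$ for some $i$ and some $n\mathbb{Z}$-totally acyclic complex. $n\mathbb{Z}\text{-}\mathrm{Gprj}\text{-}\mathcal{C}$ is the full subcategory of these modules. $\mathrm{Gprj}\text{-}\Lambda$ is the full subcategory of $\mathrm{mod}\text{-}\Lambda$ of (finitely generated) Gorenstein projective modules; it is an extension-closed subcategory and with the inherited exact structure it is a Frobenius exact category whose projective-injective objects are $\mathrm{prj}\text{-}\Lambda$, so its stable category $\underline{\mathrm{Gprj}\text{-}\Lambda}$ (morphisms modulo those factoring through projectives) is triangulated, with suspension $\Sigma$ quasi-inverse to the syzygy functor $\Omega$. $\underline{n\mathbb{Z}\text{-}\mathrm{Gprj}\text{-}\mathcal{C}}$ is the full subcategory of $\underline{\mathrm{Gprj}\text{-}\Lambda}$ on the objects of $n\mathbb{Z}\text{-}\mathrm{Gprj}\text{-}\mathcal{C}$.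 A full subcategory $\mathcal{M}$ of an exact category $\mathcal{E}$ is $n$-cluster tilting if every object of $\mathcal{E}$ has a left $\mathcal{M}$-approximation that is an admissible monomorphism and a right $\mathcal{M}$-approximation that is an admissible epimorphism, and $\mathcal{M}=\{X\in\mathcal{E}\mid \mathrm{Ext}^i_{\mathcal{E}}(\mathcal{M},X)=0,\ 0<i<n\}=\{X\in\mathcal{E}\mid \mathrm{Ext}^i_{\mathcal{E}}(X,\mathcal{M})=0,\ 0<i<n\}$; it is $n\mathbb{Z}$-cluster tilting if moreover $\mathrm{Ext}^i_{\mathcal{E}}(\mathcal{M},\mathcal{M})=0$ for all $i>0$, $i\notin n\mathbb{Z}$. For $\mathcal{E}=\mathrm{Gprj}\text{-}\Lambda$, $\mathrm{Ext}^i_{\mathcal{E}}=\mathrm{Ext}^i_\Lambda$. A full subcategory $\mathcal{U}$ of a triangulated category $(\mathcal{T},\Sigma)$ is $n$-cluster tilting if it is functorially finite and $\mathcal{U}=\{X\in\mathcal{T}\mid\mathrm{Hom}(\mathcal{U},\Sigma^iX)=0,\ 0<i<n\}=\{X\in\mathcal{T}\mid\mathrm{Hom}(X,\Sigma^i\mathcal{U})=0,\ 0<i<n\}$; it is $n\mathbb{Z}$-cluster tilting if moreover $\mathrm{Hom}(\mathcal{U},\Sigma^i\mathcal{U})=0$ for all $i\notin n\mathbb{Z}$ (equivalently, $\mathcal{U}$ is closed under $\Sigma^n$). *)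

(* Defs.v *)
From HB Require Import structures.
From mathcomp Require Import all_boot all_order all_algebra.
From mathcomp Require Import boolp.

Set Implicit Arguments.
Unset Strict Implicit.
Unset Printing Implicit Defensive.

Import GRing.Theory.
Local Open Scope ring_scope.

(* Full subcategories are predicates on modules.  [lmodType S] is the type of
   left S-modules; right modules over Lambda are obtained as left modules over
   the converse ring S := Lambda^c. *)

Section Modules.
Variable S : pzRingType.
Implicit Types X Y Z P Q M : lmodType S.

Definition surj (A B : Type) (f : A -> B) := forall y, exists x, f x = y.

Definition exact X Y Z (f : {linear X -> Y}) (g : {linear Y -> Z}) :=
  forall y, g y = 0 <-> exists x, f x = y.

Definition short_exact X Y Z (f : {linear X -> Y}) (g : {linear Y -> Z}) :=
  [/\ injective f, exact f g & surj g].

Definition iso X Y := exists f : {linear X -> Y}, bijective f.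

Definition fingen M :=
  exists (k : nat) (e : 'I_k -> M),
    forall x, exists c : 'I_k -> S, x = \sum_i c i *: e i.

Definition projective P :=
  forall X Y (g : {linear X -> Y}) (f : {linear P -> Y}), surj g ->
    exists h : {linear P -> X}, forall x, g (h x) = f x.

Definition injective_mod Q :=
  forall X Y (g : {linear X -> Y}) (f : {linear X -> Q}), injective g ->
    exists h : {linear Y -> Q}, forall x, h (g x) = f x.

Definition prj P := fingen P /\ projective P.

Definition lker_pred X Y (f : {linear X -> Y}) : {pred X} :=
  [pred x | f x == 0].

Lemma lker_pred_closed X Y (f : {linear X -> Y}) : submod_closed (lker_pred f).
Proof.
split=> [|a x y]; rewrite !inE ?linear0 // => /eqP fx /eqP fy.
by rewrite linearP fx fy scaler0 addr0.
Qed.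

HB.instance Definition _ X Y (f : {linear X -> Y}) :=
  GRing.isSubmodClosed.Build S X (lker_pred f) (lker_pred_closed f).

Definition lker_type X Y (f : {linear X -> Y}) : Type :=
  {x : X | x \in lker_pred f}.

HB.instance Definition _ X Y (f : {linear X -> Y}) :=
  SubType.on (lker_type f).
HB.instance Definition _ X Y (f : {linear X -> Y}) :=
  [Choice of lker_type f by <:].
HB.instance Definition _ X Y (f : {linear X -> Y}) :=
  [SubChoice_isSubLmodule of lker_type f by <:].

Definition lker X Y (f : {linear X -> Y}) : lmodType S := lker_type f.

(* Ext^i_S(X, Y) is the i-th cohomology of Hom_S(P, Y) for a projective
   resolution P of X; its vanishing does not depend on P. *)
Record proj_resolution X := ProjResolution {
  pr_ob : nat -> lmodType S;
  pr_d : forall k, {linear pr_ob k.+1 -> pr_ob k};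
  pr_aug : {linear pr_ob 0 -> X};
  pr_proj : forall k, projective (pr_ob k);
  pr_aug_surj : surj pr_aug;
  pr_exact0 : exact (pr_d 0) pr_aug;
  pr_exact : forall k, exact (pr_d k.+1) (pr_d k)
}.

Definition Ext_vanish (i : nat) X Y :=
  forall (P : proj_resolution X) (phi : {linear pr_ob P i -> Y}),
    (forall x, phi (pr_d P i x) = 0) ->
    match i return (pr_ob P i -> Y) -> Prop with
    | 0 => fun phi => forall x, phi x = 0
    | k.+1 => fun phi =>
        exists psi : {linear pr_ob P k -> Y}, forall x, phi x = psi (pr_d P k x)
    end phi.

Record inj_resolution X := InjResolution {
  ir_ob : nat -> lmodType S;
  ir_d : forall k, {linear ir_ob k -> ir_ob k.+1};
  ir_coaug : {linear X -> ir_ob 0};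
  ir_inj : forall k, injective_mod (ir_ob k);
  ir_coaug_inj : injective ir_coaug;
  ir_exact0 : exact ir_coaug (ir_d 0);
  ir_exact : forall k, exact (ir_d k) (ir_d k.+1)
}.

Definition finite_injdim X :=
  exists (d : nat) (I : inj_resolution X),
    forall k, (d < k)%N -> forall x : ir_ob I k, x = 0.

Definition right_approx (M : lmodType S -> Prop) X M0 (f : {linear M0 -> X}) :=
  M M0 /\ forall M1 (g : {linear M1 -> X}), M M1 ->
    exists h : {linear M1 -> M0}, forall x, g x = f (h x).

Definition left_approx (M : lmodType S -> Prop) X M0 (f : {linear X -> M0}) :=
  M M0 /\ forall M1 (g : {linear X -> M1}), M M1 ->
    exists h : {linear M0 -> M1}, forall x, g x = h (f x).

(* Subcategory of the category [fingen] of finitely generated modules. *)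
Definition functorially_finite (C : lmodType S -> Prop) :=
  forall X, fingen X ->
    (exists M0 (f : {linear M0 -> X}), right_approx C f) /\
    (exists M0 (f : {linear X -> M0}), left_approx C f).

Record n_cluster_tilting (n : nat) (C : lmodType S -> Prop) : Prop := {
  ct_sub : forall X, C X -> fingen X;
  ct_ff : functorially_finite C;
  ct_right : forall X, C X <->
    fingen X /\ forall i Y, (0 < i < n)%N -> C Y -> Ext_vanish i Y X;
  ct_left : forall X, C X <->
    fingen X /\ forall i Y, (0 < i < n)%N -> C Y -> Ext_vanish i X Y
}.

Definition nZ_cluster_tilting (n : nat) (C : lmodType S -> Prop) :=
  n_cluster_tilting n C /\
  forall i X Y, (0 < i)%N -> ~~ (n %| i)%N -> C X -> C Y -> Ext_vanish i X Y.

(* The differential is a family P^i -> P^j over all pairs (i, j), vanishing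
   unless j = i + 1; this avoids transports along equalities of indices. *)
Record complex := Complex {
  cob :> int -> lmodType S;
  cd : forall i j, {linear cob i -> cob j};
  cd_shape : forall i j, j != i + 1 -> forall x, cd i j x = 0;
  cd_comp : forall i j k x, cd j k (cd i j x) = 0
}.

Definition cycles (P : complex) (j : int) : lmodType S := lker (cd P j (j + 1)).

Lemma to_cycles_subproof (P : complex) i j (x : P i) :
  cd P i j x \in lker_pred (cd P j (j + 1)).
Proof. by rewrite inE cd_comp. Qed.

(* The map P^i -> Z^j induced by the differential (of interest for j = i + 1). *)
Definition to_cycles (P : complex) i j (x : P i) : cycles P j :=
  exist _ (cd P i j x) (to_cycles_subproof j x).

Definition acyclic (P : complex) :=
  forall j, exact (cd P (j - 1) j) (cd P j (j + 1)).

(* Acyclicity of Hom(-, Q) applied to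
   0 -> Z^a -> P^a -> P^(a+1) -> ... -> P^(b-1) -> Z^b -> 0   (a < b),
   at Hom(Z^b, Q), at each Hom(P^j, Q) with a <= j < b, and at Hom(Z^a, Q).
   The map into P^j is the inclusion of Z^a if j = a, and the map out of P^j
   is the corestriction to Z^b if j = b - 1. *)
Definition Hom_acyclic_segment (P : complex) (a b : int) Q :=
  [/\ forall phi : {linear cycles P b -> Q},
        (forall x : P (b - 1), phi (to_cycles b x) = 0) ->
        forall z, phi z = 0,
      forall j (psi : {linear P j -> Q}), (a <= j < b)%R ->
        (if j == a then forall z : cycles P j, psi (val z) = 0
         else forall x : P (j - 1), psi (cd P (j - 1) j x) = 0) ->
        (if j == b - 1 then
           exists phi : {linear cycles P b -> Q},
             forall x, psi x = phi (to_cycles b x)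
         else
           exists phi : {linear P (j + 1) -> Q},
             forall x, psi x = phi (cd P j (j + 1) x))
    & forall phi : {linear cycles P a -> Q},
        exists psi : {linear P a -> Q}, forall z, phi z = psi (val z)].

Definition nZ_totally_acyclic (n : nat) (C : lmodType S -> Prop) (P : complex) :=
  [/\ forall j, prj (P j),
      acyclic P,
      forall (i : int) Q, projective Q ->
        Hom_acyclic_segment P (i * n%:Z) ((i + 1) * n%:Z) Q
    & forall i : int, C (cycles P (i * n%:Z))].

Definition nZ_Gprj (n : nat) (C : lmodType S -> Prop) G :=
  C G /\ exists (P : complex) (i : int),
    nZ_totally_acyclic n C P /\ iso G (cycles P (i * n%:Z)).

Definition totally_acyclic (P : complex) :=
  [/\ forall j, prj (P j),
      acyclic P
    & forall Q, projective Q -> forall j (psi : {linear P j -> Q}),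
        (forall x, psi (cd P (j - 1) j x) = 0) ->
        exists phi : {linear P (j + 1) -> Q},
          forall x, psi x = phi (cd P j (j + 1) x)].

Definition Gprj G :=
  exists (P : complex) (j : int), totally_acyclic P /\ iso G (cycles P j).

(* Conflations of the exact category Gprj are the short exact sequences of
   modules with all three terms in Gprj. *)
Definition Gprj_adm_mono X Y (f : {linear X -> Y}) :=
  [/\ Gprj X, Gprj Y
    & exists Z (g : {linear Y -> Z}), Gprj Z /\ short_exact f g].

Definition Gprj_adm_epi X Y (g : {linear X -> Y}) :=
  [/\ Gprj X, Gprj Y
    & exists Z (f : {linear Z -> X}), Gprj Z /\ short_exact f g].

(* The Ext groups of the exact category Gprj are those of the module category,
   as Gprj is extension-closed, contains prj and is closed under syzygies. *)
Record n_cluster_tilting_Gprj (n : nat) (M : lmodType S -> Prop) : Prop := {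
  ctG_sub : forall X, M X -> Gprj X;
  ctG_left_approx : forall X, Gprj X ->
    exists M0 (f : {linear X -> M0}), left_approx M f /\ Gprj_adm_mono f;
  ctG_right_approx : forall X, Gprj X ->
    exists M0 (f : {linear M0 -> X}), right_approx M f /\ Gprj_adm_epi f;
  ctG_right : forall X, M X <->
    Gprj X /\ forall i Y, (0 < i < n)%N -> M Y -> Ext_vanish i Y X;
  ctG_left : forall X, M X <->
    Gprj X /\ forall i Y, (0 < i < n)%N -> M Y -> Ext_vanish i X Y
}.

Definition nZ_cluster_tilting_Gprj (n : nat) (M : lmodType S -> Prop) :=
  n_cluster_tilting_Gprj n M /\
  forall i X Y, (0 < i)%N -> ~~ (n %| i)%N -> M X -> M Y -> Ext_vanish i X Y.

(* The stable category of Gprj: objects are those of Gprj, morphisms are linear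
   maps up to [stable_eq]. *)
Record Gprj_ob := GprjOb { Gprj_mod :> lmodType S; Gprj_modP : Gprj Gprj_mod }.

Definition factors_prj X Y (f : X -> Y) :=
  exists P (a : {linear X -> P}) (b : {linear P -> Y}),
    prj P /\ forall x, f x = b (a x).

Definition stable_eq X Y (f g : X -> Y) := factors_prj (fun x => f x - g x).

Definition stable_Hom_vanish X Y :=
  forall f : {linear X -> Y}, stable_eq f (fun=> 0).

Definition Gprj_conflation_prj (X Y : Gprj_ob) :=
  exists P (f : {linear X -> P}) (g : {linear P -> Y}),
    prj P /\ short_exact f g.

Lemma Gprj_cycles (P : complex) j : totally_acyclic P -> Gprj (cycles P j).
Proof. by move=> tP; exists P, j; split=> //; exists idfun; exists idfun. Qed.

Lemma cycles_short_exact (P : complex) i j : j = i + 1 -> acyclic P ->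
  exists (f : {linear cycles P i -> P i}) (g : {linear P i -> cycles P j}),
    short_exact f g.
Proof.
move=> -> acP.
pose f : {linear cycles P i -> P i} := (val : lker_type (cd P i (i + 1)) -> P i).
have glin : linear (@to_cycles P i (i + 1) : P i -> cycles P (i + 1)).
  by move=> a x y; apply: val_inj; rewrite /= linearP.
pose gm := GRing.isLinear.Build _ _ _ _ (@to_cycles P i (i + 1)) glin.
pose g : {linear P i -> cycles P (i + 1)} := HB.pack (@to_cycles P i (i + 1)) gm.
exists f, g; split; first exact: val_inj.
- move=> y; split.
  + move=> /(congr1 val) /= dy.
    have yP : y \in lker_pred (cd P i (i + 1)) by rewrite inE dy.
    by exists (exist _ y yP).
  + case=> [[x xP]] /= <-; apply: val_inj => /=.
    by move: xP; rewrite inE => /eqP.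
- case=> y yP; have /eqP dy : cd P (i + 1) (i + 1 + 1) y == 0 := yP.
  have [+ _] := acP (i + 1) y; rewrite addrK => /(_ dy) [x dx].
  by exists x; apply: val_inj.
Qed.

Lemma short_exact_isol X X' Y Z (h : {linear X -> X'}) (f : {linear X' -> Y})
    (g : {linear Y -> Z}) : bijective h -> short_exact f g ->
  short_exact (f \o h : {linear X -> Y}) g.
Proof.
move=> [k hk kh] [finj fg gs]; split=> //; first exact: inj_comp (can_inj hk).
move=> y; split.
- by case/fg => x <-; exists (k x); rewrite /= kh.
- by case=> x <-; apply/fg; exists (h x).
Qed.

Lemma short_exact_isor X Y Z Z' (h : {linear Z' -> Z}) (f : {linear X -> Y})
    (g : {linear Y -> Z}) : bijective h -> short_exact f g ->
  exists g' : {linear Y -> Z'}, short_exact f g'.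
Proof.
move=> [k hk kh] [finj fg gs].
have kglin : linear (k \o g : Y -> Z').
  by move=> a x y; apply: (can_inj hk); rewrite /= linearP kh !linearP !kh.
pose g' : {linear Y -> Z'} :=
  HB.pack (k \o g) (GRing.isLinear.Build _ _ _ _ (k \o g) kglin).
exists g'; split=> //.
- move=> y; rewrite -fg /=; split=> [kgy|->]; last first.
    by apply: (can_inj hk); rewrite kh linear0.
  by rewrite -[g y]kh kgy linear0.
- by move=> z; case: (gs (h z)) => y gy; exists y; rewrite /= gy hk.
Qed.

Lemma exists_suspension (X : Gprj_ob) : exists Y : Gprj_ob, Gprj_conflation_prj X Y.
Proof.
case: X => X [P [j [tP [h hbij]]]]; have [prjP acP _] := tP.
have [f [g fg]] := cycles_short_exact (erefl (j + 1)) acP.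
exists (GprjOb (Gprj_cycles (j + 1) tP)).
exists (P j), (f \o h : {linear X -> P j}), g; split=> //.
exact: short_exact_isol.
Qed.

Lemma exists_syzygy (X : Gprj_ob) : exists Y : Gprj_ob, Gprj_conflation_prj Y X.
Proof.
case: X => X [P [j [tP [h hbij]]]]; have [prjP acP _] := tP.
have ej : j = j - 1 + 1 by rewrite subrK.
have [f [g fg]] := cycles_short_exact ej acP.
exists (GprjOb (Gprj_cycles (j - 1) tP)).
have [g' fg'] := short_exact_isor hbij fg.
by exists (P (j - 1)), f, g'.
Qed.

(* Object parts of the suspension and of its quasi-inverse, the syzygy: the
   outer terms of chosen conflations X -> P -> Sigma X and Omega X -> P -> X
   in Gprj with P in prj (both well defined up to stable isomorphism). *)
Definition Sigma (X : Gprj_ob) : Gprj_ob := sval (cid (exists_suspension X)).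

Definition Omega (X : Gprj_ob) : Gprj_ob := sval (cid (exists_syzygy X)).

Definition Sigma_pow (i : int) (X : Gprj_ob) : Gprj_ob :=
  match i with
  | Posz k => iter k Sigma X
  | Negz k => iter k.+1 Omega X
  end.

Definition functorially_finite_stable (U : Gprj_ob -> Prop) :=
  forall X : Gprj_ob,
    (exists (U0 : Gprj_ob) (f : {linear U0 -> X}), U U0 /\
       forall (U1 : Gprj_ob) (g : {linear U1 -> X}), U U1 ->
         exists h : {linear U1 -> U0}, stable_eq g (fun x => f (h x))) /\
    (exists (U0 : Gprj_ob) (f : {linear X -> U0}), U U0 /\
       forall (U1 : Gprj_ob) (g : {linear X -> U1}), U U1 ->
         exists h : {linear U0 -> U1}, stable_eq g (fun x => h (f x))).

Record n_cluster_tilting_stable (n : nat) (U : Gprj_ob -> Prop) : Prop := {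
  ctS_ff : functorially_finite_stable U;
  ctS_right : forall X : Gprj_ob, U X <->
    forall (i : int) (Y : Gprj_ob), (0 < i < n%:Z)%R -> U Y ->
      stable_Hom_vanish Y (Sigma_pow i X);
  ctS_left : forall X : Gprj_ob, U X <->
    forall (i : int) (Y : Gprj_ob), (0 < i < n%:Z)%R -> U Y ->
      stable_Hom_vanish X (Sigma_pow i Y)
}.

Definition nZ_cluster_tilting_stable (n : nat) (U : Gprj_ob -> Prop) :=
  n_cluster_tilting_stable n U /\
  forall (i : int) (X Y : Gprj_ob), ~~ (n%:Z %| i)%Z -> U X -> U Y ->
    stable_Hom_vanish X (Sigma_pow i Y).

Definition stable_nZ_Gprj (n : nat) (C : lmodType S -> Prop) (X : Gprj_ob) :=
  nZ_Gprj n C X.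

End Modules.

Definition ideal_pred (R : comPzRingType) (I : R -> Prop) :=
  [/\ I 0, forall x y, I x -> I y -> I (x + y) & forall a x, I x -> I (a * x)].

Definition artinian (R : comPzRingType) :=
  forall I : nat -> R -> Prop,
    (forall k, ideal_pred (I k)) -> (forall k x, I k.+1 x -> I k x) ->
    exists N, forall k, (N <= k)%N -> forall x, I N x -> I k x.

Definition artin_algebra (R : comPzRingType) (Lambda : algType R) :=
  artinian R /\ fingen (Lambda : lmodType R).

(* (Lambda^c)^o is Lambda as a right module over itself. *)
Definition Iwanaga_Gorenstein (Lambda : pzRingType) :=
  finite_injdim ((Lambda^c)^o : lmodType Lambda^c) /\
  finite_injdim (Lambda^o : lmodType Lambda).

(* Main.v *)
(* Call a module X perpendicular to S = Lambda^op if it is finitely generated and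
   Ext^i(X, S) = 0 for all i > 0. Dualising into left modules, where Lambda has
   finite injective dimension, shows that such an X embeds into a free module
   with perpendicular cokernel; hence these are the Gorenstein projective
   modules, and far enough syzygies of finitely generated modules are among
   them. Write M for the modules of C that are perpendicular.

   If X in M has an n-th cosyzygy X' inside the perpendicular modules, then
   Ext^i(X', Y) = Ext^(i+n)(X', Omega^n Y) = Ext^i(X, Omega^n Y) = 0 for Y in C
   and 0 < i < n, so X' is in M: therefore M is the class of nZ-Gorenstein
   projectives. The syzygy functor is fully faithful on perpendicular modules up
   to maps factoring through projectives, so an M-approximation of X is obtained
   as Omega^(nm) of a C-approximation of an nm-th cosyzygy of X, for m large.
   The condition Ext^i(X, M) = 0 gives Ext^i(X, C) = 0 by shifting both arguments
   nm times; the condition Ext^i(M, X) = 0 is reduced to it by an induction along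
   left M-approximations. In the stable category Hom(X, Sigma^i Y) is
   Ext^i(X, Y). *)

From HB Require Import structures.
From mathcomp Require Import all_boot all_order all_algebra.
From mathcomp Require Import boolp functions.
Require Import Defs.

Set Implicit Arguments.
Unset Strict Implicit.
Unset Printing Implicit Defensive.

Import GRing.Theory.
Local Open Scope ring_scope.

(** * Linear maps and free modules *)

(** [Ext_vanish] and total acyclicity quantify over projectives of any size. So free modules on
    arbitrary sets supply presentations, and a map from a finitely generated module to a projective
    is pushed through some S^m. No Ext groups are built: vanishing is a recursive predicate on
    presentations, and each piece of a long exact sequence becomes an implication proved by lifting
    and extending maps. The two halves of the Gorenstein hypothesis do different work: finite
    injective dimension on the left yields cosyzygies, on the right it makes high syzygies
    perpendicular. The shift is d * n, where Ext into S vanishes in degrees above d: a multiple of n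
    because C is stable under n-th syzygies, and at least d because n is positive. Syzygies
    determine maps only modulo projectives, so a transported approximation is correct up to a map
    through a projective. Adding a projective summand absorbs this error and also makes the
    approximation an admissible epimorphism or monomorphism. Syzygies stay finitely generated
    because Lambda is noetherian on both sides; as only the descending chain condition on R is
    given, the ideals of R are first shown to be finitely generated. *)

Definition to_linear (S : pzRingType) (X Y : lmodType S) (f : X -> Y)
    (lin_f : linear f) : {linear X -> Y} :=
  HB.pack f (GRing.isLinear.Build _ _ _ _ f lin_f).

Section LinearMaps.
Variable S : pzRingType.
Implicit Types X Y Z P Q A B K : lmodType S.

Lemma linear_factor_surj X Y Z (g : {linear X -> Y}) (f : {linear X -> Z}) :
  surj g -> (forall x, g x = 0 -> f x = 0) ->
  exists h : {linear Y -> Z}, forall x, f x = h (g x).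
Proof.
move=> gs gf.
have gf2 x x' : g x = g x' -> f x = f x'.
  move=> e; apply/eqP; rewrite -subr_eq0 -linearB; apply/eqP/gf.
  by rewrite linearB e subrr.
have [s sP] := choice gs.
have slin : linear (f \o s).
  by move=> a u v /=; rewrite -linearP; apply: gf2; rewrite linearP !sP.
by exists (to_linear slin) => x /=; apply: gf2; rewrite sP.
Qed.

Lemma linear_factor_inj X Y Z (f : {linear Y -> Z}) (h : {linear X -> Z}) :
  injective f -> (forall x, exists y, f y = h x) ->
  exists g : {linear X -> Y}, forall x, f (g x) = h x.
Proof.
move=> fi /choice[g gP].
have glin : linear g by move=> a u v; apply: fi; rewrite linearP !gP linearP.
by exists (to_linear glin).
Qed.

Lemma linear_pair X Y Z (f : {linear X -> Y}) (g : {linear X -> Z}) :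
  exists h : {linear X -> (Y * Z)%type}, forall x, h x = (f x, g x).
Proof.
have lin : linear (fun x => (f x, g x) : (Y * Z)%type).
  by move=> a u v; rewrite !linearP.
by exists (to_linear lin).
Qed.

Lemma linear_copair X Y Z (f : {linear X -> Z}) (g : {linear Y -> Z}) :
  exists h : {linear (X * Y)%type -> Z}, forall x y, h (x, y) = f x + g y.
Proof.
pose h : {linear (X * Y)%type -> Z} := (f \o fst) \+ (g \o snd).
by exists h.
Qed.

Lemma exact0 X Y Z (f : {linear X -> Y}) (g : {linear Y -> Z}) x :
  exact f g -> g (f x) = 0.
Proof. by move=> fg; apply/fg; exists x. Qed.

Definition lker_incl X Y (f : {linear X -> Y}) : {linear lker f -> X} :=
  (val : lker_type f -> X).

Lemma lker_inclP X Y (f : {linear X -> Y}) z : f (lker_incl f z) = 0.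
Proof. by case: z => z zP; have /eqP : f z == 0 := zP. Qed.

Lemma short_exact_lker X Y (g : {linear X -> Y}) :
  surj g -> short_exact (lker_incl g) g.
Proof.
move=> gs; split=> // y; split=> [gy|[x <-]]; last exact: lker_inclP.
have yP : y \in lker_pred g by rewrite inE gy.
by exists (exist _ y yP).
Qed.

Lemma surj_short_exact X Y (g : {linear X -> Y}) : surj g ->
  exists K (f : {linear K -> X}), short_exact f g.
Proof.
by move=> gs; exists (lker g), (lker_incl g); apply: short_exact_lker.
Qed.

Lemma iso_sym X Y : iso X Y -> iso Y X.
Proof.
move=> [f [g fg gf]].
have glin : linear g by move=> a u v; apply: (can_inj fg);
  rewrite gf linearP !gf.
by exists (to_linear glin); exists f.
Qed.

Lemma short_exact_lift X Y Z A (f : {linear X -> Y}) (g : {linear Y -> Z})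
    (h : {linear A -> Y}) : short_exact f g -> (forall a, g (h a) = 0) ->
  exists k : {linear A -> X}, forall a, f (k a) = h a.
Proof. by move=> [fi fg _] gh; apply: linear_factor_inj => // a; apply/fg. Qed.

Lemma short_exact_desc X Y Z A (f : {linear X -> Y}) (g : {linear Y -> Z})
    (h : {linear Y -> A}) : short_exact f g -> (forall a, h (f a) = 0) ->
  exists k : {linear Z -> A}, forall y, h y = k (g y).
Proof.
by move=> [_ fg gs] hf; apply: linear_factor_surj => // y /fg[x <-].
Qed.

Lemma projective_prod P Q : projective P -> projective Q ->
  projective (P * Q)%type.
Proof.
move=> pP pQ X Y g f gs.
have [i iE] := linear_pair (idfun : {linear P -> P}) (\0 : {linear P -> Q}).
have [j jE] := linear_pair (\0 : {linear Q -> P}) (idfun : {linear Q -> Q}).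
have [h hE] := pP _ _ g (f \o i : {linear _ -> _}) gs.
have [k kE] := pQ _ _ g (f \o j : {linear _ -> _}) gs.
have [u uE] := linear_copair h k; exists u => -[x y].
rewrite uE linearD hE kE /= -linearD iE jE; congr (f _).
by rewrite /idfun /= -[LHS]/(x + 0, 0 + y) addr0 add0r.
Qed.

End LinearMaps.
Arguments lker_inclP [S X Y] f z.
Arguments lker_incl : simpl never.

(** * Free modules, finitely generated or not *)

Section FreeModules.
Variable S : pzRingType.

Lemma rV_projective k : projective ('rV[S]_k : lmodType S).
Proof.
move=> X Y g f gs; have [s sP] := choice gs.
have lin : linear (fun v : 'rV[S]_k => \sum_i v 0 i *: s (f (delta_mx 0 i))).
  move=> a u v /=; rewrite scaler_sumr -big_split; apply: eq_bigr => i _ /=.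
  by rewrite !mxE scalerDl scalerA.
exists (to_linear lin) => x /=; rewrite linear_sum [x in RHS]row_sum_delta.
by rewrite linear_sum; apply: eq_bigr => i _; rewrite !linearZ sP.
Qed.

Lemma rV_fingen k : fingen ('rV[S]_k : lmodType S).
Proof.
exists k, (fun i => delta_mx 0 i) => x; exists (fun i => x 0 i).
exact: row_sum_delta.
Qed.

Lemma rV_prj k : prj ('rV[S]_k : lmodType S).
Proof. by split; [apply: rV_fingen|apply: rV_projective]. Qed.

Lemma linear_of_family (X : lmodType S) k (e : 'I_k -> X) :
  exists g : {linear 'rV[S]_k -> X}, forall v, g v = \sum_i v 0 i *: e i.
Proof.
have lin : linear (fun v : 'rV[S]_k => \sum_i v 0 i *: e i).
  move=> a u v /=; rewrite scaler_sumr -big_split; apply: eq_bigr => i _ /=.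
  by rewrite !mxE scalerDl scalerA.
by exists (to_linear lin).
Qed.

Lemma fingen_cover (X : lmodType S) : fingen X ->
  exists k (g : {linear 'rV[S]_k -> X}), surj g.
Proof.
move=> [k [e eP]]; have [g gE] := linear_of_family e.
exists k, g => y; have [c ->] := eP y; exists (\row_i c i).
by rewrite gE; apply: eq_bigr => i _; rewrite mxE.
Qed.

Lemma fingen_surj (X Y : lmodType S) (g : {linear X -> Y}) :
  surj g -> fingen X -> fingen Y.
Proof.
move=> gs [k [e eP]]; exists k, (g \o e) => y; have [x <-] := gs y.
have [c ->] := eP x; exists c.
by rewrite linear_sum; apply: eq_bigr => i _; rewrite linearZ.
Qed.

Lemma fingen_prod (X Y : lmodType S) :
  fingen X -> fingen Y -> fingen (X * Y)%type.
Proof.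
move=> /fingen_cover[k [f fs]] /fingen_cover[l [g gs]].
have lin : linear (fun v : 'rV[S]_(k + l) => (f (lsubmx v), g (rsubmx v))
  : X * Y).
  by move=> a u v; rewrite !linearP.
apply: (@fingen_surj _ _ (to_linear lin)) (rV_fingen _) => -[x y].
have [u <-] := fs x; have [v <-] := gs y; exists (row_mx u v) => /=.
by rewrite row_mxKl row_mxKr.
Qed.

Section Free.
Variable T : choiceType.

Definition finsupp_pred : {pred (T -> S^o)} :=
  [pred f : T -> S^o | `[< exists s : seq T, forall t, t \notin s ->
    f t = 0 >]].

Lemma finsupp_closed : submod_closed finsupp_pred.
Proof.
split=> [|a u v]; first by apply/asboolP; exists [::].
rewrite !inE => /asboolP[s sP] /asboolP[r rP]; apply/asboolP; exists (s ++ r).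
move=> t; rewrite mem_cat negb_or => /andP[ts tr].
have -> : (a *: u + v) t = a *: u t + v t by [].
by rewrite sP // rP // scaler0 addr0.
Qed.

HB.instance Definition _ :=
  GRing.isSubmodClosed.Build S (T -> S^o) finsupp_pred finsupp_closed.

(** Finite support on an arbitrary set: presentations of modules that are not finitely generated are
    needed as well. *)
Definition free_mod : Type := {f : T -> S^o | f \in finsupp_pred}.

HB.instance Definition _ := SubType.on free_mod.
HB.instance Definition _ := [Choice of free_mod by <:].
HB.instance Definition _ := [SubChoice_isSubLmodule of free_mod by <:].

Definition fcoef (f : free_mod) (t : T) : S := val f t.

Definition supp_in (f : free_mod) (s : seq T) :=
  forall t, t \notin s -> fcoef f t = 0.

Lemma supp_inP (f : free_mod) : exists s, supp_in f s.
Proof. by case: f => f fP; apply/asboolP. Qed.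

Lemma supp_in_undup f s : supp_in f s -> supp_in f (undup s).
Proof. by move=> fs t; rewrite mem_undup; apply: fs. Qed.

(** Supports are picked by choice; independence of the list is what makes the map in [free_mod_map]
    linear. *)
Lemma supp_sum (X : lmodType S) (e : T -> X) f s s' :
  uniq s -> uniq s' -> supp_in f s -> supp_in f s' ->
  \sum_(t <- s) fcoef f t *: e t = \sum_(t <- s') fcoef f t *: e t.
Proof.
have red r : \sum_(t <- r) fcoef f t *: e t =
    \sum_(t <- [seq t <- r | fcoef f t != 0]) fcoef f t *: e t.
  rewrite big_filter [RHS]big_mkcond /=; apply: eq_bigr => t _.
  by case: eqP => //= ->; rewrite scale0r.
move=> us us' fs fs'; rewrite red [RHS]red; apply: perm_big.
apply: uniq_perm; rewrite ?filter_uniq // => t; rewrite !mem_filter.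
case: eqP => //= ft; case: (boolP (t \in s)) => ts; last by case: ft; apply: fs.
by case: (boolP (t \in s')) => // ts'; case: ft; apply: fs'.
Qed.

Lemma free_mod_map (X : lmodType S) (e : T -> X) :
  exists g : {linear free_mod -> X},
    forall f s, uniq s -> supp_in f s -> g f = \sum_(t <- s) fcoef f t *: e t.
Proof.
have [s sP] := choice supp_inP.
pose g (f : free_mod) := \sum_(t <- undup (s f)) fcoef f t *: e t.
have gE f r : uniq r -> supp_in f r -> g f = \sum_(t <- r) fcoef f t *: e t.
  by move=> ur fr; apply: supp_sum; rewrite ?undup_uniq //;
    apply: supp_in_undup.
have lin : linear g.
  move=> a u v; set r := undup (s u ++ s v).
  have ur : uniq r := undup_uniq _.
  have inu : supp_in u r.
    by move=> t; rewrite mem_undup mem_cat negb_or => /andP[/sP].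
  have inv : supp_in v r.
    by move=> t; rewrite mem_undup mem_cat negb_or => /andP[_ /sP].
  have inuv : supp_in (a *: u + v) r.
    move=> t tr; have -> : fcoef (a *: u + v)
      t = a * fcoef u t + fcoef v t by [].
    by rewrite inu // inv // mulr0 addr0.
  rewrite !(gE _ r) // scaler_sumr -big_split; apply: eq_bigr => t _ /=.
  by rewrite scalerA -scalerDl.
by exists (to_linear lin).
Qed.

Lemma free_basis_subproof (t : T) :
  (fun u => (u == t)%:R : S^o) \in finsupp_pred.
Proof.
rewrite inE; apply/asboolP; exists [:: t] => u.
by rewrite inE => /negbTE->.
Qed.

Definition free_basis (t : T) : free_mod := exist (fun f => f \in finsupp_pred)
  _ (free_basis_subproof t).

Lemma free_mod_map_basis (X : lmodType S) (e : T -> X) :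
  exists2 g : {linear free_mod -> X},
    forall f s, uniq s -> supp_in f s -> g f = \sum_(t <- s) fcoef f t *: e t &
    forall t, g (free_basis t) = e t.
Proof.
have [g gE] := free_mod_map e; exists g => // t.
rewrite (gE _ [:: t]) ?big_seq1 /fcoef //= ?eqxx ?scale1r // => u.
by rewrite /fcoef inE /= => /negbTE->.
Qed.

Lemma free_mod_projective : projective free_mod.
Proof.
move=> X Y g f gs; have [s sP] := choice gs.
have [h hE _] := free_mod_map_basis (s \o f \o free_basis).
exists h => x; have [r /supp_in_undup rP] := supp_inP x.
have ur := undup_uniq r; rewrite (hE _ _ ur rP) linear_sum.
have [k kE kb] := free_mod_map_basis free_basis.
have xE : x = k x.
  rewrite (kE _ _ ur rP); apply: val_inj; apply: funext => t;
    rewrite -!/(fcoef _ t).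
  pose ev (f : free_mod) := fcoef f t.
  have evD : {morph ev : u v / u + v} by [].
  rewrite -[RHS]/(ev _) (big_morph ev evD (erefl _)).
  have evZ a u : ev (a *: u) = a * ev u by [].
  under eq_bigr => u _ do rewrite evZ.
  case: (boolP (t \in undup r)) => tr.
    rewrite (bigD1_seq t) //= big1 => [|u /negbTE ut].
      by rewrite /ev /fcoef /= eqxx addr0 mulr1.
    by rewrite /ev /fcoef /= eq_sym ut mulr0.
  rewrite big_seq big1 ?rP // => u ur'; rewrite /ev /fcoef /=.
  have -> : (t == u) = false by apply: contraNF tr => /eqP->.
  by rewrite mulr0.
rewrite [in RHS]xE (kE _ _ ur rP) linear_sum; apply: eq_bigr => t _.
by rewrite !linearZ /= sP.
Qed.

End Free.

Lemma enough_projectives (X : lmodType S) :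
  exists (P : lmodType S) (g : {linear P -> X}), projective P /\ surj g.
Proof.
have [g _ gb] := free_mod_map_basis (id : X -> X).
exists (free_mod X), g; split; first exact: free_mod_projective.
by move=> x; exists (free_basis x).
Qed.

(** Q is a summand of the free module on its elements, and the finitely many generators of K involve
    only finitely many basis elements. This reduces Ext into any projective to Ext into S. *)
Lemma projective_fingen_factor (K Q : lmodType S) (f : {linear K -> Q}) :
  fingen K -> projective Q ->
  exists k (u : {linear K -> 'rV[S]_k}) (v : {linear 'rV[S]_k -> Q}),
    forall x, f x = v (u x).
Proof.
move=> [k [e eP]] pQ.
have [g gE gb] := free_mod_map_basis (id : Q -> Q).
have gs : surj g by move=> x; exists (free_basis x).
have [h hE] := pQ _ _ g idfun gs.
have [s sP] := choice (fun i => supp_inP (h (f (e i)))).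
pose r := undup (flatten [seq s i | i <- enum 'I_k]).
have fr x : supp_in (h (f x)) r.
  have [c ->] := eP x => t; rewrite mem_undup => tr; rewrite !linear_sum.
  pose ev (f : free_mod Q) := fcoef f t.
  have evD : {morph ev : u v / u + v} by [].
  rewrite -[LHS]/(ev _) (big_morph ev evD (erefl _)) big1 // => i _.
  rewrite !linearZ; have -> a u : ev (a *: u) = a * ev u by [].
  rewrite /ev sP ?mulr0 //; apply: contra tr => ts.
  by apply/flatten_mapP; exists i; rewrite ?mem_enum.
pose u x : 'rV[S]_(size r) := \row_i fcoef (h (f x)) (nth 0 r i).
have ulin : linear u.
  by move=> a x y; apply/rowP => i; rewrite !mxE !linearP.
have [v vE] := linear_of_family (fun i : 'I_(size r) => nth 0 r i).
exists (size r), (to_linear ulin), v => x.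
rewrite vE -[LHS]hE (gE _ _ (undup_uniq _) (fr x)) (big_nth 0) big_mkord.
by apply: eq_bigr => i _; rewrite mxE.
Qed.

End FreeModules.

(** * Vanishing of Ext *)

Section Ext.
Variable S : pzRingType.
Implicit Types X Y Z P Q A B K M : lmodType S.

Definition extends_along K P (f : {linear K -> P}) Y :=
  forall u : {linear K -> Y}, exists v : {linear P -> Y}, forall x,
    u x = v (f x).

(* [ext k X Y] is the vanishing of Ext^(k+1)(X, Y). *)
Fixpoint ext (k : nat) X Y : Prop :=
  forall K P (f : {linear K -> P}) (g : {linear P -> X}),
    projective P -> short_exact f g ->
    if k is l.+1 then ext l K Y else extends_along f Y.

Definition factors_proj X Y (f : X -> Y) :=
  exists P (a : {linear X -> P}) (b : {linear P -> Y}),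
    projective P /\ forall x, f x = b (a x).

(* X' is a direct summand of X in the category of modules modulo projectives. *)
Definition stable_retract X' X :=
  exists (a : {linear X' -> X}) (b : {linear X -> X'}),
    factors_proj (fun x => x - b (a x)).

Lemma projective_cover_seq X :
  exists K P (f : {linear K -> P}) (g : {linear P -> X}),
    projective P /\ short_exact f g.
Proof.
have [P [g [pP gs]]] := enough_projectives X.
by exists (lker g), P, (lker_incl g), g; split=> //; apply: short_exact_lker.
Qed.

Lemma factors_proj0 X Y (f : X -> Y) : (forall x, f x = 0) -> factors_proj f.
Proof.
move=> f0; exists 'rV[S]_0, \0, \0; split; first exact: rV_projective.
by move=> x; rewrite f0.
Qed.

Lemma retract_stable_retract X' X (a : {linear X' -> X}) (b : {linear X -> X'})
  :
  (forall x, b (a x) = x) -> stable_retract X' X.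
Proof.
by move=> ba; exists a, b; apply: factors_proj0 => x; rewrite ba subrr.
Qed.

Lemma stable_retract_refl X : stable_retract X X.
Proof. exact: (@retract_stable_retract _ _ idfun idfun). Qed.

Lemma iso_stable_retract X' X : iso X' X -> stable_retract X' X.
Proof.
move=> [f [g fg gf]].
have glin : linear g by move=> a u v; apply: (can_inj fg);
  rewrite gf linearP !gf.
exact: (@retract_stable_retract _ _ f (to_linear glin)).
Qed.

Lemma prod_stable_retract X Q : projective Q -> stable_retract (X * Q)%type X.
Proof.
move=> pQ.
have [i iE] := linear_pair (idfun : {linear X -> X}) (\0 : {linear X -> Q}).
have [j jE] := linear_pair (\0 : {linear Q -> X}) (idfun : {linear Q -> Q}).
exists fst, i, Q, snd, j; split=> // -[x y]; rewrite iE jE /=.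
by apply: injective_projections => /=; rewrite ?subrr ?subr0.
Qed.

Lemma stable_retract_prod X Q : stable_retract X (X * Q)%type.
Proof.
have [i iE] := linear_pair (idfun : {linear X -> X}) (\0 : {linear X -> Q}).
by apply: (@retract_stable_retract _ _ i fst) => x; rewrite iE.
Qed.

(** Lift a and b to maps A and B of the projectives. The identity of P' minus B A minus the lifted
    map through Q takes values in K', which gives the homotopy W. This plays the role of Schanuel's
    lemma in comparing presentations. *)
Lemma stable_retract_lift X' X K K' P P'
    (f : {linear K -> P}) (g : {linear P -> X})
    (f' : {linear K' -> P'}) (g' : {linear P' -> X'}) :
  projective P -> short_exact f g -> projective P' -> short_exact f' g' ->
  stable_retract X' X ->
  exists (A : {linear P' -> P}) (a : {linear K' -> K}) (b : {linear K -> K'})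
      (W : {linear P' -> K'}),
    (forall x, f (a x) = A (f' x)) /\ (forall x, x = b (a x) + W (f' x)).
Proof.
move=> pP fg pP' fg' [a [b [Q [v [u [pQ ab]]]]]].
have [fi fgE gs] := fg; have [fi' fgE' gs'] := fg'.
have [A AE] := pP' _ _ g (a \o g' : {linear _ -> _}) gs.
have [B BE] := pP _ _ g' (b \o g : {linear _ -> _}) gs'.
have [U UE] := pQ _ _ g' u gs'.
have [|a' aE'] := short_exact_lift (h := A \o f' : {linear _ -> _}) fg.
  by move=> x /=; rewrite AE /= (exact0 _ fgE') linear0.
have [|b' bE'] := short_exact_lift (h := B \o f : {linear _ -> _}) fg'.
  by move=> x /=; rewrite BE /= (exact0 _ fgE) linear0.
pose w : {linear P' -> P'} := (idfun \- (B \o A)) \- (U \o (v \o g')).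
have [|W WE] := short_exact_lift (h := w) fg'.
  move=> x; rewrite /w /= !linearB /= BE /= AE /= UE.
  by rewrite -ab subrr.
exists A, a', b', W; split=> // x; apply: fi'.
rewrite linearD WE /w /= bE' /= aE' /= (exact0 _ fgE') !linear0 addr0.
by rewrite addrC subrK.
Qed.

Lemma stable_retract_syzygy X' X K K' P P'
    (f : {linear K -> P}) (g : {linear P -> X})
    (f' : {linear K' -> P'}) (g' : {linear P' -> X'}) :
  projective P -> short_exact f g -> projective P' -> short_exact f' g' ->
  stable_retract X' X -> stable_retract K' K.
Proof.
move=> pP fg pP' fg' XX.
have [A [a [b [W [_ E]]]]] := stable_retract_lift pP fg pP' fg' XX.
exists a, b, P', f', W; split=> // x.
by rewrite {1}[x]E addrC addKr.
Qed.

Lemma ext_stable_retract k X' X Y : stable_retract X' X -> ext k X Y ->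
  ext k X' Y.
Proof.
elim: k X' X => [|k IHk] X' X XX /= eX K' P' f' g' pP' fg'.
  have [K [P [f [g [pP fg]]]]] := projective_cover_seq X.
  have [A [a [b [W [aA E]]]]] := stable_retract_lift pP fg pP' fg' XX.
  move=> u; have [v vE] := eX _ _ _ _ pP fg (u \o b : {linear _ -> _}).
  exists ((v \o A) \+ (u \o W) : {linear _ -> _}) => x /=.
  by rewrite -aA -vE /= -linearD -E.
have [K [P [f [g [pP fg]]]]] := projective_cover_seq X.
apply: (IHk _ K) (eX _ _ _ _ pP fg).
exact: (stable_retract_syzygy pP fg pP' fg' XX).
Qed.

(** [ext] quantifies over all presentations, but one suffices: X is a stable retract of itself, so
    any syzygy of X is a stable retract of any other. *)
Lemma ext_syzygy k X Y K P (f : {linear K -> P}) (g : {linear P -> X}) :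
  projective P -> short_exact f g -> ext k K Y -> ext k.+1 X Y.
Proof.
move=> pP fg eK K' P' f' g' pP' fg'; apply: ext_stable_retract eK.
exact: (stable_retract_syzygy pP fg pP' fg' (stable_retract_refl X)).
Qed.

Lemma ext0_syzygy X Y K P (f : {linear K -> P}) (g : {linear P -> X}) :
  projective P -> short_exact f g -> extends_along f Y -> ext 0 X Y.
Proof.
move=> pP fg eK K' P' f' g' pP' fg'.
have [A [a [b [W [aA E]]]]] :=
  stable_retract_lift pP fg pP' fg' (stable_retract_refl X).
move=> u; have [v vE] := eK (u \o b : {linear _ -> _}).
exists ((v \o A) \+ (u \o W) : {linear _ -> _}) => x /=.
by rewrite -aA -vE /= -linearD -E.
Qed.

Lemma ext_projective k P Y : projective P -> ext k P Y.
Proof.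
move=> pP; have fg : short_exact (\0 : {linear 'rV[S]_0 -> P}) idfun.
  split=> //; first by move=> x y _; rewrite (thinmx0 x) (thinmx0 y).
  - move=> y; split=> [/= ->|[x <-]] //; by exists 0.
  - by move=> y; exists y.
have e0 f : extends_along (f : {linear 'rV[S]_0 -> P}) Y.
  by move=> u; exists \0 => x; rewrite (thinmx0 x) linear0.
elim: k P pP fg e0 => [|k IHk] P pP fg e0.
  exact: ext0_syzygy pP fg (e0 _).
apply: ext_syzygy pP fg _; apply: IHk; first exact: rV_projective.
  split=> //; first by move=> x y _; rewrite (thinmx0 x) (thinmx0 y).
  - move=> y; split=> [/= ->|[x <-]] //; by exists 0.
  - by move=> y; exists y.
by move=> f u; exists \0 => x; rewrite (thinmx0 x) linear0.
Qed.

Section SecondVariable.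
Variables (Y' Q Y : lmodType S) (i : {linear Y' -> Q}) (p : {linear Q -> Y}).
Hypothesis ip : short_exact i p.

(** The exact piece Ext^(k+1)(X, Q) -> Ext^(k+1)(X, Y) -> Ext^(k+2)(X, Y'). In lowest degree the
    obstruction to lifting a map K -> Y to Q lives on the second syzygy of X, where the second
    hypothesis removes it. *)
Lemma ext_quotient k X : ext k X Q -> ext k.+1 X Y' -> ext k X Y.
Proof.
have [ii ipE ps] := ip.
elim: k X => [|k IHk] X /= eQ eY' K P f g pP fg; last first.
  by apply: IHk; [apply: eQ pP fg|apply: eY' pP fg].
move=> u.
have [K2 [P1 [f1 [g1 [pP1 fg1]]]]] := projective_cover_seq K.
have [_ fgE1 gs1] := fg1.
have [w wE] := pP1 _ _ p (u \o g1 : {linear _ -> _}) ps.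
have [|w' wE'] := short_exact_lift (h := w \o f1 : {linear _ -> _}) ip.
  by move=> x /=; rewrite wE /= (exact0 _ fgE1) linear0.
have [t tE] := eY' _ _ _ _ pP fg _ _ _ _ pP1 fg1 w'.
have [|r rE] := short_exact_desc (h := w \- (i \o t) : {linear _ -> _}) fg1.
  by move=> x /=; rewrite -tE wE' subrr.
have [q qE] := eQ _ _ _ _ pP fg r.
exists (p \o q : {linear _ -> _}) => x /=; rewrite -qE.
have [y <-] := gs1 x; rewrite -rE /= linearB wE (exact0 _ ipE).
by rewrite subr0.
Qed.

(** The exact piece Ext^(k+1)(X, Y) -> Ext^(k+2)(X, Y') -> Ext^(k+2)(X, Q). The extension of i u to
    Q is corrected by a lift along p so that it lands in Y'. *)
Lemma ext_sub k X : ext k X Y -> ext k.+1 X Q -> ext k.+1 X Y'.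
Proof.
have [ii ipE ps] := ip.
elim: k X => [|k IHk] X /= eY eQ K P f g pP fg; last first.
  by apply: (IHk K); [apply: eY pP fg|apply: eQ pP fg].
move=> K2 P1 f1 g1 pP1 fg1 u; have [_ fgE1 gs1] := fg1.
have [t tE] := eQ _ _ _ _ pP fg _ _ _ _ pP1 fg1 (i \o u : {linear _ -> _}).
have [|r rE] := short_exact_desc (h := p \o t : {linear _ -> _}) fg1.
  by move=> x /=; rewrite -tE (exact0 _ ipE).
have [q qE] := eY _ _ _ _ pP fg r.
have [q' qE'] := pP _ _ p q ps.
pose w : {linear P1 -> Q} := t \- (q' \o (f \o g1)).
have [|v vE] := short_exact_lift (h := w) ip.
  by move=> x; rewrite /w /= linearB qE' -qE -rE subrr.
exists v => x; apply: ii; rewrite vE /w /= -tE (exact0 _ fgE1) !linear0.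
by rewrite addr0.
Qed.

End SecondVariable.

Lemma horseshoe A B X (i : {linear A -> B}) (p : {linear B -> X})
    (KA PA KX PX : lmodType S) (f : {linear KA -> PA}) (g : {linear PA -> A})
    (f' : {linear KX -> PX}) (g' : {linear PX -> X}) :
  short_exact i p -> projective PX -> short_exact f g -> short_exact f' g' ->
  exists (KB : lmodType S) (fB : {linear KB -> (PA * PX)%type})
      (gB : {linear (PA * PX)%type -> B})
      (j : {linear KA -> KB}) (q : {linear KB -> KX}),
    [/\ short_exact fB gB, short_exact j q,
        forall x, fB (j x) = (f x, 0) & forall y, (fB y).2 = f' (q y)].
Proof.
move=> ip pPX fg fg'; have [ii ipE ps] := ip.
have [fi fgE gs] := fg; have [fi' fgE' gs'] := fg'.
have [h hE] := pPX _ _ p g' ps.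
have [gB gBE] := linear_copair (i \o g : {linear _ -> _}) h.
have gBs : surj gB.
  move=> b; have [y yE] := gs' (p b).
  have /ipE[a aE] : p (b - h y) = 0 by rewrite linearB hE yE subrr.
  have [x xE] := gs a; exists (x, y).
  by rewrite gBE /= xE aE subrK.
have kB := short_exact_lker gBs.
have [c cE] := linear_pair f (\0 : {linear KA -> PX}).
have [|j jE] := short_exact_lift (h := c) kB.
  by move=> x; rewrite cE gBE /= (exact0 _ fgE) !linear0 addr0.
have snd0 y : g' (lker_incl gB y).2 = 0.
  have := lker_inclP gB y; case: (lker_incl gB y) => u v; rewrite gBE /=.
  by move/(congr1 p); rewrite linearD (exact0 _ ipE) add0r hE linear0.
have [|q qE] := short_exact_lift (h := snd \o lker_incl gB : {linear _ -> _})
  fg'.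
  exact: snd0.
exists (lker gB), (lker_incl gB), gB, j, q; split=> //; last by move=> x;
  rewrite jE.
split.
- move=> x y /(congr1 (lker_incl gB)); rewrite !jE !cE => -[] /fi.
  exact.
- move=> y; split; last first.
    by move=> [x <-]; apply: fi';
      rewrite qE -[LHS]/(lker_incl gB (j x)).2 jE cE linear0.
  move=> qy; have y2 : (lker_incl gB y).2 = 0.
    by rewrite -(linear0 f') -qy qE.
  have yE : lker_incl gB y = ((lker_incl gB y).1, 0) by rewrite -y2;
    case: (lker_incl gB y).
  have := lker_inclP gB y; rewrite yE gBE linear0 addr0 -[RHS](linear0 i).
  move=> /ii /fgE[x xE]; exists x; have [kBi _ _] := kB; apply: kBi.
  by rewrite jE cE yE xE.
- move=> z.
  have /ipE[a aE] : p (h (f' z)) = 0 by rewrite hE (exact0 _ fgE').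
  have [x xE] := gs a.
  have yP : (- x, f' z) \in lker_pred gB.
    by rewrite inE gBE /= linearN linearN xE aE addNr.
  exists (exist _ (- x, f' z) yP : lker_type gB); apply: fi'.
  by rewrite qE.
Qed.

Lemma ext_middle k A B X (i : {linear A -> B}) (p : {linear B -> X}) Y :
  short_exact i p -> ext k A Y -> ext k X Y -> ext k B Y.
Proof.
elim: k A B X i p => [|k IHk] A B X i p ip eA eX.
all: have [KA [PA [f [g [pPA fg]]]]] := projective_cover_seq A.
all: have [KX [PX [f' [g' [pPX fg']]]]] := projective_cover_seq X.
all: have [KB [fB [gB [j [q [kB jq jE qE]]]]]] := horseshoe ip pPX fg fg'.
all: have pPB := projective_prod pPA pPX.
  apply: (ext0_syzygy pPB kB) => u.
  have [v vE] := eA _ _ _ _ pPA fg (u \o j : {linear _ -> _}).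
  have [|w wE] := short_exact_desc (h := u \- (v \o (fst \o fB)) : {linear _ ->
    _}) jq.
    by move=> x /=; rewrite jE -vE subrr.
  have [t tE] := eX _ _ _ _ pPX fg' w.
  exists ((v \o fst) \+ (t \o snd) : {linear _ -> _}) => y /=.
  by rewrite qE -tE -wE /= addrC subrK.
apply: (ext_syzygy pPB kB).
by apply: IHk jq _ _; [apply: eA pPA fg|apply: eX pPX fg'].
Qed.

(** In degree zero, surjectivity of Hom(B, Y) -> Hom(A, Y) replaces the vanishing of an Ext of A.
    The kernel K1 of P -> B -> X contains K with quotient A, so a map on K1 is extended first from
    K, then from A. *)
Lemma ext0_cokernel A B X (i : {linear A -> B}) (p : {linear B -> X}) Y :
  short_exact i p -> ext 0 B Y -> extends_along i Y -> ext 0 X Y.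
Proof.
move=> ip eB eAB; have [ii ipE ps] := ip.
have [K [P [f [g [pP fg]]]]] := projective_cover_seq B.
have [fi fgE gs] := fg.
have pgs : surj (p \o g : {linear _ -> _}).
  by move=> x; have [b <-] := ps x; have [y <-] := gs b; exists y.
have [K1 [f1 fg1]] := surj_short_exact pgs; have [f1i f1E _] := fg1.
apply: (ext0_syzygy pP fg1) => u.
have [|c cE] := short_exact_lift (h := f) fg1.
  by move=> x /=; rewrite (exact0 _ fgE) linear0.
have [|q qE] := short_exact_lift (h := g \o f1 : {linear _ -> _}) ip.
  by move=> x; apply: (exact0 _ f1E).
have qs : surj q.
  move=> a; have [y yE] := gs (i a).
  have /f1E[x xE] : p (g y) = 0 by rewrite yE (exact0 _ ipE).
  by exists x; apply: ii; rewrite qE /= xE.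
have [v vE] := eB _ _ _ _ pP fg (u \o c : {linear _ -> _}).
have [|w wE] := linear_factor_surj (f := u \- (v \o f1) : {linear _ -> _}) qs.
  move=> y qy; have /fgE[x xE] : g (f1 y) = 0 by rewrite -[LHS]qE qy linear0.
  have -> : y = c x by apply: f1i; rewrite cE.
  by rewrite /= cE -vE subrr.
have [t tE] := eAB w.
exists (v \+ (t \o g) : {linear _ -> _}) => y /=.
by rewrite -[g (f1 y)]qE -tE -wE /= addrC subrK.
Qed.

(** The syzygy K1 of X obtained from a presentation of B sits in 0 -> K -> K1 -> A -> 0 with K a
    syzygy of B, so [ext_middle] applies to it. *)
Lemma ext_cokernel k A B X (i : {linear A -> B}) (p : {linear B -> X}) Y :
  short_exact i p -> ext k A Y -> ext k.+1 B Y -> ext k.+1 X Y.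
Proof.
move=> ip eA eB; have [ii ipE ps] := ip.
have [K [P [f [g [pP fg]]]]] := projective_cover_seq B.
have [fi fgE gs] := fg.
have pgs : surj (p \o g : {linear _ -> _}).
  by move=> x; have [b <-] := ps x; have [y <-] := gs b; exists y.
have [K1 [f1 fg1]] := surj_short_exact pgs; have [f1i f1E _] := fg1.
apply: (ext_syzygy pP fg1).
have [|c cE] := short_exact_lift (h := f) fg1.
  by move=> x /=; rewrite (exact0 _ fgE) linear0.
have [|q qE] := short_exact_lift (h := g \o f1 : {linear _ -> _}) ip.
  by move=> x; apply: (exact0 _ f1E).
apply: (@ext_middle k _ _ _ c q) => //; last exact: eB pP fg.
split.
- by move=> x y /(congr1 f1); rewrite !cE => /fi.
- move=> y; split=> [qy|[x <-]].
    have /fgE[x xE] : g (f1 y) = 0 by rewrite -[LHS]qE qy linear0.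
    by exists x; apply: f1i; rewrite cE.
  by apply: ii; rewrite qE /= cE (exact0 _ fgE) linear0.
- move=> a; have [y yE] := gs (i a).
  have /f1E[x xE] : p (g y) = 0 by rewrite yE (exact0 _ ipE).
  by exists x; apply: ii; rewrite qE /= xE.
Qed.

(** Pulling back along P -> X gives 0 -> K -> A + P -> B -> 0 with K a syzygy of X, and A is a
    summand of A + P. *)
Lemma ext_kernel k A B X (i : {linear A -> B}) (p : {linear B -> X}) Y :
  short_exact i p -> ext k B Y -> ext k.+1 X Y -> ext k A Y.
Proof.
move=> ip eB eX; have [ii ipE ps] := ip.
have [K [P [f [g [pP fg]]]]] := projective_cover_seq X.
have [fi fgE gs] := fg.
have [h hE] := pP _ _ p g ps.
have [q qE] := linear_copair i h.
have [|c cE] := short_exact_lift (h := h \o f : {linear _ -> _}) ip.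
  by move=> x /=; rewrite hE (exact0 _ fgE).
have [j jE] := linear_pair (\- c : {linear _ -> _}) f.
apply: (@ext_stable_retract k A (A * P)%type); first exact: stable_retract_prod.
apply: (@ext_middle k _ _ _ j q) => //; last exact: eX pP fg.
split.
- by move=> x y; rewrite !jE => -[_ /fi].
- case=> a y; rewrite qE; split=> [e|[x]]; last first.
    by rewrite jE => -[<- <-]; rewrite /= linearN cE addNr.
  have /fgE[x xE] : g y = 0.
    by move/(congr1 p): e; rewrite linearD (exact0 _ ipE) add0r hE linear0.
  exists x; rewrite jE xE; congr pair; apply: ii; apply/eqP.
  by rewrite linearN cE /= xE eq_sym -addr_eq0 e.
- move=> b; have [y yE] := gs (p b).
  have /ipE[a aE] : p (b - h y) = 0 by rewrite linearB hE yE subrr.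
  by exists (a, y); rewrite qE aE subrK.
Qed.

Lemma ext_injective k X I : injective_mod I -> ext k X I.
Proof.
move=> inj_I; elim: k X => [|k IHk] X K P f g pP fg; last exact: IHk.
by move=> u; have [fi _ _] := fg; have [v vE] := inj_I _ _ f u fi; exists v.
Qed.

Lemma finite_injdim_ext Y : finite_injdim Y ->
  exists d, forall k X, (d <= k)%N -> ext k X Y.
Proof.
(* After the shift, d bounds the number of possibly nonzero terms: d = 0 forces Y = 0, and each
   induction step drops the first term. *)
move=> [d [I I0]]; exists d.+1; move: I0; move: (d.+1) => {}d.
elim: d Y I => [|d IHd] Y [I dI e inj_I ei ex0 ex] /= I0 k X dk.
  have Y0 y : y = 0 :> Y by apply: ei; rewrite linear0; apply: I0.
  elim: k X {dk} => [|k IHk] X K P f g pP fg; last exact: IHk.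
  by move=> u; exists \0 => x; apply: Y0.
case: k dk => // k dk.
pose Y1 := lker (dI 1); pose f := lker_incl (dI 1).
have fi : injective f by apply: (@val_inj _ _ (lker_type (dI 1))).
have [|p pE] := linear_factor_inj (h := dI 0) fi.
  move=> x; have xP : dI 0 x \in lker_pred (dI 1).
    by rewrite inE; apply/eqP/ex; exists x.
  by exists (exist _ (dI 0 x) xP : lker_type _).
have ip : short_exact e p.
  split=> // [y|y].
    rewrite -ex0 -pE; split=> [->|]; first by rewrite linear0.
    by rewrite -[RHS](linear0 f) => /fi.
  have /ex[x xE] := lker_inclP (dI 1) y.
  by exists x; apply: fi; rewrite pE.
apply: (ext_sub ip); last exact: ext_injective.
have ex1 : exact f (dI 1).
  move=> y; split=> [dy|[x <-]]; last exact: lker_inclP.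
  have yP : y \in lker_pred (dI 1) by rewrite inE dy.
  by exists (exist _ y yP : lker_type _).
pose J := @InjResolution S Y1 (fun k => I k.+1) (fun k => dI k.+1) f
  (fun k => inj_I k.+1) fi ex1 (fun k => ex k.+1).
apply: (IHd Y1 J) => // l dl x; exact: I0.
Qed.

(** Induction strips off the term in degree 0: the kernel of the augmentation is resolved by the
    shifted complex. *)
Lemma resolution_ext k X (P : proj_resolution X) Y :
  ext k X Y <->
  forall phi : {linear pr_ob P k.+1 -> Y}, (forall x, phi (pr_d P k.+1 x) = 0)
    ->
    exists psi : {linear pr_ob P k -> Y}, forall x, phi x = psi (pr_d P k x).
Proof.
elim: k X P => [|k IHk] X [P d e pP es ex0 ex] /=.
all: have fg := short_exact_lker es; set f := lker_incl e in fg.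
all: have [fi fgE _] := fg.
all: have [|q qE] := short_exact_lift (h := d 0) fg;
  first by (move=> x; apply/ex0; exists x).
all: have qs : surj q by (move=> z; have /ex0[x xE] := lker_inclP e z;
  exists x; apply: fi; rewrite qE).
  split=> [eX phi phi0|H].
    have [|w wE] := linear_factor_surj (f := phi) qs.
      move=> x qx; have /ex[y <-] : d 0 x = 0 by rewrite -qE qx linear0.
      exact: phi0.
    have [v vE] := eX _ _ _ _ (pP 0%N) fg w.
    by exists v => x; rewrite wE vE qE.
  apply: (ext0_syzygy (pP 0%N) fg) => u.
  have [|v vE] := H (u \o q : {linear _ -> _}).
    move=> x /=; have -> : q (d 1 x) = 0; last by rewrite linear0.
    by apply: fi; rewrite qE linear0; apply/ex; exists x.
  by exists v => z; have [x <-] := qs z; rewrite [LHS]vE qE.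
have exq : exact (d 1) q.
  move=> y; rewrite -ex -qE; split=> [->|]; first by rewrite linear0.
  by rewrite -[RHS](linear0 f) => /fi.
pose R := @ProjResolution S (lker e) (fun k => P k.+1) (fun k => d k.+1) q
  (fun k => pP k.+1) qs exq (fun k => ex k.+1).
rewrite -(IHk _ R); split=> [eX|]; first exact: eX (pP 0%N) fg.
exact: ext_syzygy (pP 0%N) fg.
Qed.

(** A presentation packaged as data, so that one can be chosen for every module and iterated; no
    minimality is meant. *)
Record projective_cover X := ProjectiveCover {
  cover_ker : lmodType S;
  cover_ob : lmodType S;
  cover_incl : {linear cover_ker -> cover_ob};
  cover_map : {linear cover_ob -> X};
  cover_proj : projective cover_ob;
  cover_exact : short_exact cover_incl cover_map
}.

(** [Ext_vanish] ranges over all resolutions and would say nothing about a module that had none. *)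
Lemma proj_resolution_exists X : inhabited (proj_resolution X).
Proof.
have cov Z : projective_cover Z.
  apply: inhabited_witness.
  have [K [P [f [g [pP fg]]]]] := projective_cover_seq Z.
  by split; exists K P f g.
pose Z k := iter k (fun Z => cover_ker (cov Z)) X.
pose P k := cover_ob (cov (Z k)).
pose d k : {linear P k.+1 -> P k} :=
  cover_incl (cov (Z k)) \o cover_map (cov (Z k.+1)).
have exd k (W : lmodType S) (h : {linear P k -> W}) :
    exact (cover_incl (cov (Z k))) h -> exact (d k) h.
  move=> ih y; rewrite ih; split=> [] [x <-].
    have [_ _ gs] := cover_exact (cov (Z k.+1)); have [w <-] := gs x.
    by exists w.
  by exists (cover_map (cov (Z k.+1)) x).
split; exists P d (cover_map (cov X)).
- by move=> k; apply: cover_proj.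
- by have [] := cover_exact (cov X).
- by apply: exd; have [] := cover_exact (cov X).
- move=> k; apply: exd => y.
  have [_ <- _] := cover_exact (cov (Z k.+1)).
  have [fi _ _] := cover_exact (cov (Z k)).
  rewrite /d /=; split=> [|->]; last by rewrite linear0.
  by rewrite -[RHS](linear0 (cover_incl (cov (Z k)))) => /fi.
Qed.

Lemma Ext_vanishS k X Y : Ext_vanish k.+1 X Y <-> ext k X Y.
Proof.
split=> [H|eX P]; last by apply/resolution_ext.
have [P] := proj_resolution_exists X.
by apply/(resolution_ext _ P) => phi; apply: H.
Qed.

Definition perp X := fingen X /\ forall k, ext k X S^o.

End Ext.

(** B is the quotient of A + P by a copy of K, so u on A and an extension v of u c to P descend
    together to B. This carries the extension property from projective middle terms to arbitrary
    ones. *)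
Lemma ext0_extends (S : pzRingType) (A B X Y : lmodType S)
    (i : {linear A -> B}) (p : {linear B -> X}) :
  short_exact i p -> ext 0 X Y -> extends_along i Y.
Proof.
move=> ip eX u; have [ii ipE ps] := ip.
have [K [P [f [g [pP fg]]]]] := projective_cover_seq X.
have [fi fgE gs] := fg.
have [h hE] := pP _ _ p g ps.
have [|c cE] := short_exact_lift (h := h \o f : {linear _ -> _}) ip.
  by move=> x /=; rewrite hE (exact0 _ fgE).
have [v vE] := eX _ _ _ _ pP fg (u \o c : {linear _ -> _}).
have [q qE] := linear_copair i h; have [w wE] := linear_copair u v.
have qs : surj q.
  move=> b; have [y yE] := gs (p b).
  have /ipE[a aE] : p (b - h y) = 0 by rewrite linearB hE yE subrr.
  by exists (a, y); rewrite qE aE subrK.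
have [|t tE] := linear_factor_surj (f := w) qs.
  case=> a y; rewrite qE wE => e.
  have /fgE[x xE] : g y = 0.
    by move/(congr1 p): e; rewrite linearD (exact0 _ ipE) add0r hE linear0.
  have -> : a = - c x.
    by apply: ii; rewrite linearN cE /= xE; apply/eqP; rewrite -addr_eq0 e.
  by rewrite -xE -vE linearN addNr.
exists t => a; have := tE (a, 0).
by rewrite wE qE !linear0 !addr0.
Qed.

(** * Noetherianity of artin algebras *)

Section Span.
Variable R : comPzRingType.
Implicit Types V W : lmodType R.

Definition submod_pred V (N : V -> Prop) :=
  [/\ N 0, forall x y, N x -> N y -> N (x + y) & forall a x, N x -> N (a *: x)].

Fixpoint span V (s : seq V) (x : V) : Prop :=
  if s is a :: s' then exists r, span s' (x - r *: a) else x = 0.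

Definition fg_pred V (N : V -> Prop) := exists s, forall x, N x <-> span s x.

Lemma span_submod V (s : seq V) : submod_pred (span s).
Proof.
elim: s => [|a s [s0 sD sZ]] /=.
  by split=> // [x y -> ->|b x ->]; rewrite ?addr0 ?scaler0.
split; first by exists 0; rewrite scale0r subr0.
- move=> x y [r xr] [t yt]; exists (r + t).
  by rewrite scalerDl opprD addrACA; apply: sD.
- move=> b x [r xr]; exists (b * r); rewrite -scalerA -scalerBr; exact: sZ.
Qed.

Lemma span_cons V (a : V) s x : span s x -> span (a :: s) x.
Proof. by move=> sx; exists 0; rewrite scale0r subr0. Qed.

Lemma span_mem V (s : seq V) x : x \in s -> span s x.
Proof.
elim: s => // a s IHs; rewrite inE => /predU1P[->|/IHs]; last exact: span_cons.
by exists 1; rewrite scale1r subrr; have [] := span_submod s.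
Qed.

Lemma span_sub V (N : V -> Prop) s :
  submod_pred N -> (forall x, x \in s -> N x) -> forall x, span s x -> N x.
Proof.
move=> NS; have [N0 ND NZ] := NS.
elim: s => [_ x -> //|a s IHs] Ns x [r /IHs]; rewrite -[N x]/(N x) => H.
rewrite -(subrK (r *: a) x); apply: ND; last by apply/NZ/Ns/mem_head.
by apply: H => y ys; apply: Ns; rewrite inE ys orbT.
Qed.

Lemma span_cat V (s t : seq V) x :
  span (s ++ t) x <-> exists2 y, span s y & span t (x - y).
Proof.
elim: s x => [|a s IHs] x /=.
  by split=> [tx|[y ->]]; [exists 0 => //|]; rewrite subr0.
split=> [[r /IHs[y sy ty]]|[y [r sy] ty]].
  exists (y + r *: a); first by exists r; rewrite addrK.
  by rewrite opprD addrCA addrC.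
by exists r; apply/IHs; exists (y - r *: a); rewrite // opprB addrA subrK.
Qed.

(* A linear relation T plays the role of a linear map defined on a submodule:
   its domain is an extension of its image by its kernel. *)
Lemma fg_pred_ext V W (T : V -> W -> Prop) :
  T 0 0 -> (forall x x' y y', T x y -> T x' y' -> T (x + x') (y + y')) ->
  (forall a x y, T x y -> T (a *: x) (a *: y)) ->
  fg_pred (fun y => exists x, T x y) -> fg_pred (fun x => T x 0) ->
  fg_pred (fun x => exists y, T x y).
Proof.
move=> T0 TD TZ [s sP] [k kP].
have [t tP] : exists t : seq V, (forall x, x \in t -> exists y, T x y) /\
    forall y, span s y -> exists2 x, span t x & T x y.
  have : forall a, a \in s -> exists x, T x a by move=> a /span_mem/sP.
  elim: s {sP} => [|a s IHs] aT.
    by exists [::]; split=> // y ->; exists 0.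
  have [t [tT ts]] : exists t : seq V, (forall x, x \in t -> exists y, T x y) /\
      forall y, span s y -> exists2 x, span t x & T x y.
    by apply: IHs => b bs; apply: aT; rewrite inE bs orbT.
  have [x xa] := aT a (mem_head _ _); exists (x :: t); split.
    by move=> z; rewrite inE => /predU1P[->|/tT//]; exists a.
  move=> y [r /ts[z tz zT]]; exists (z + r *: x); first by exists r;
    rewrite addrK.
  by rewrite -(subrK (r *: a) y); apply: TD => //; apply: TZ.
have [tT ts] := tP; exists (t ++ k) => x; split=> [[y xy]|/span_cat[y ty kxy]].
  have [z tz zy] := ts y ((sP y).1 (ex_intro _ x xy)).
  apply/span_cat; exists z => //; apply/kP.
  rewrite -(subrr y) -(scaleN1r y) -[- z]scaleN1r.
  by apply: TD => //; apply: TZ.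
have [w yw] : exists w, T y w.
  apply: (span_sub (N := fun y => exists w, T y w)) ty => //.
  split; first by exists 0.
    by move=> u v [u' uT] [v' vT]; exists (u' + v'); apply: TD.
  by move=> a u [u' uT]; exists (a *: u'); apply: TZ.
exists (w + 0); rewrite -(subrK y x) addrC; apply: TD => //; exact/kP.
Qed.

End Span.

(** * Ideals of a commutative artinian ring are finitely generated *)

Section Artinian.
Variable R : comPzRingType.
Hypothesis artR : artinian R.
Implicit Types I J : R^o -> Prop.

Lemma artinian_minimal (F : (R^o -> Prop) -> Prop) I0 :
  submod_pred I0 -> F I0 ->
  exists I, [/\ submod_pred I, F I & forall J, submod_pred J -> F J ->
    (forall x, J x -> I x) -> forall x, I x -> J x].
Proof.
move=> sI0 FI0; apply: contrapT => noI.
pose D := {I : R^o -> Prop | submod_pred I /\ F I}.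
have next (I : D) : exists J : D,
    (forall x, sval J x -> sval I x) /\ exists2 x, sval I x & ~ sval J x.
  case: I => I [sI FI] /=; apply: contrapT => noJ; apply: noI; exists I.
  split=> // J sJ FJ JI x Ix; apply: contrapT => nJx; apply: noJ.
  by exists (exist _ J (conj sJ FJ)); split=> //; exists x.
have [nx nxP] := choice next.
pose C k := iter k nx (exist _ I0 (conj sI0 FI0)).
have [||N NP] := artR (I := fun k => sval (C k)).
- by move=> k; case: (C k) => I [[]].
- by move=> k x; apply: (nxP (C k)).1.
have [x Ix nIx] := (nxP (C N)).2.
by apply: nIx; apply: (NP N.+1).
Qed.

Section MinimalNotFg.
Variable I : R^o -> Prop.
Hypotheses (sI : submod_pred I) (nfI : ~ fg_pred I).
Hypothesis minI : forall J, submod_pred J -> ~ fg_pred J ->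
  (forall x, J x -> I x) -> forall x, I x -> J x.

(* A minimal non-finitely generated ideal I satisfies r I = 0 or r I = I for each
   r, so the scalars act on I through a field. If g_0, g_1, ... in I are linearly
   independent, then g_1, g_2, ... span a smaller ideal that is not finitely
   generated either. *)
Lemma minimal_scale r :
  (forall x, I x -> r * x = 0) \/ (forall y, I y -> exists2 x, I x & y = r * x).
Proof.
have [I0 ID IZ] := sI.
apply: contrapT => /not_orP[nr0 nr1].
pose T (x y : R^o) := I x /\ y = r * x.
apply: nfI; have -> : I = (fun x => exists y, T x y).
  apply: funext => x; apply: propext; split=> [Ix|[y []//]].
  by exists (r * x).
apply: fg_pred_ext.
- by split; rewrite ?mulr0.
- by move=> x x' y y' [Ix ->] [Ix' ->]; split; [apply: ID|rewrite mulrDr].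
- move=> a x y [Ix ->]; split; first exact: IZ.
  by rewrite -[LHS]/(a * (r * x)) mulrCA.
- apply: contrapT => nf; apply: nr1 => y /(minI _ nf) H.
  have [||x [Ix ->]] := H; last by exists x.
    split; first by exists 0; split; rewrite ?mulr0.
      move=> u v [x [Ix ->]] [z [Iz ->]]; exists (x + z).
      by split; [apply: ID|rewrite mulrDr].
    move=> a u [x [Ix ->]]; exists (a *: x); split; first exact: IZ.
    by rewrite -[LHS]/(a * (r * x)) mulrCA.
  by move=> u [x [Ix ->]]; apply: IZ.
- apply: contrapT => nf; apply: nr0 => y /(minI _ nf) H.
  have [||Iy e] := H; last by rewrite -e.
    split; first by split; rewrite ?mulr0.
      by move=> u v [Iu u0] [Iv v0]; split;
        [apply: ID|rewrite mulrDr -u0 -v0 addr0].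
    move=> a u [Iu u0]; split; first exact: IZ.
    by rewrite -[_ * _]/(r * (a * u)) mulrCA -u0 mulr0.
  by move=> u [].
Qed.

Lemma minimal_inv r : ~ (forall x, I x -> r * x = 0) ->
  exists b, forall x, I x -> x = b * (r * x).
Proof.
move=> nr; have [I0 ID IZ] := sI.
(* The scalars acting on I as multiples of r^k form a descending chain of ideals. Where it stops,
   r^N acts as b r^(N+1), and b is the candidate inverse of r. *)
pose J k (a : R) := exists b, forall x, I x -> a * x = b * (r ^+ k * x).
have [||N NP] := artR (I := J).
- move=> k; split; first by exists 0 => x _; rewrite !mul0r.
    by move=> a a' [b bE] [b' bE']; exists (b + b') => x Ix;
      rewrite !mulrDl bE ?bE'.
  by move=> c a [b bE]; exists (c * b) => x Ix; rewrite -!mulrA bE.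
- move=> k a [b bE]; exists (b * r) => x Ix.
  by rewrite bE // exprS !mulrA.
have [b bE] : J N.+1 (r ^+ N).
  by apply: (NP N.+1) => //; exists 1 => x _; rewrite mul1r.
exists b => x Ix; apply/eqP; rewrite -subr_eq0; apply/eqP.
have surj_r : forall y, I y -> exists2 x, I x & y = r * x.
  by case: (minimal_scale r).
have surj_rN k : forall y, I y -> exists2 x, I x & y = r ^+ k * x.
  elim: k => [|k IHk] y Iy; first by exists y; rewrite ?mul1r.
  have [z Iz ->] := surj_r _ Iy; have [w Iw ->] := IHk _ Iz.
  by exists w; rewrite // exprS mulrA.
case: (minimal_scale (1 - b * r)) => [H|H].
  by rewrite -[RHS](H x Ix) mulrBl mul1r mulrA.
(* Here I = (1 - b r) r^N I = 0, which the empty list generates. *)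
case: nfI; exists [::] => y /=; split=> [Iy|-> //].
have [z Iz ->] := H _ Iy; have [w Iw ->] := surj_rN N _ Iz.
by rewrite mulrBl mul1r {1}bE // exprS -!mulrA subrr.
Qed.

Lemma minimal_absurd : False.
Proof.
have [I0 ID IZ] := sI.
have pickP (L : seq R^o) : exists x : R^o,
    (forall y, y \in L -> I y) -> I x /\ ~ span L x.
  (* The value 0 is a placeholder for lists not contained in I; it makes the choice total. *)
  case: (pselect (forall y, y \in L -> I y)) => [LI|nLI]; last by exists 0.
  apply: contrapT => nox; apply: nfI; exists L => x.
  split; last exact: span_sub.
  by move=> Ix; apply: contrapT => nLx; apply: nox; exists x.
have [pk pkP] := choice pickP.
pose fix L k : seq R^o := if k is l.+1 then pk (L l) :: L l else [::].
pose g k := pk (L k).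
have LI k : forall y, y \in L k -> I y.
  elim: k => //= k IHk y; rewrite inE => /predU1P[->|/IHk//].
  by have [] := pkP _ IHk.
have gI k : I (g k) by have [] := pkP _ (@LI k).
have gL k : ~ span (L k) (g k) by have [] := pkP _ (@LI k).
pose fix L' k : seq R^o := if k is l.+1 then g l.+1 :: L' l else [::].
have LE k : L k.+1 = L' k ++ [:: g 0%N].
  by elim: k => //= k IHk; rewrite -IHk.
pose J x := exists k, span (L' k) x.
have L'mono k l x : (k <= l)%N -> span (L' k) x -> span (L' l) x.
  move=> /subnK <-; elim: (l - k)%N => // d IHd /IHd; exact: span_cons.
have sJ : submod_pred J.
  split; first by exists 0%N.
  - move=> x y [k kx] [l ly]; exists (maxn k l).
    have [_ + _] := span_submod (L' (maxn k l)); apply.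
      by apply: L'mono kx; apply: leq_maxl.
    by apply: L'mono ly; apply: leq_maxr.
  - by move=> a x [k kx]; exists k; have [_ _] := span_submod (L' k); apply.
have nfJ : ~ fg_pred J.
  move=> [s sP].
  have [k sk] : exists k, forall x, x \in s -> span (L' k) x.
    have : forall x, x \in s -> J x by move=> x /span_mem/sP.
    elim: s {sP} => [|a s IHs] sJ'; first by exists 0%N.
    have [k ka] := sJ' a (mem_head _ _).
    have [|l ls] := IHs; first by move=> x xs; apply: sJ'; rewrite inE xs orbT.
    exists (maxn k l) => x; rewrite inE => /predU1P[->|/ls].
      by apply: L'mono ka; apply: leq_maxl.
    by apply: L'mono; apply: leq_maxr.
  apply: (gL k.+1); rewrite LE; apply/span_cat; exists (g k.+1).
    apply: (span_sub (span_submod (L' k)) sk); apply/sP; exists k.+1.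
    exact/span_mem/mem_head.
  by rewrite subrr; have [] := span_submod [:: g 0%N].
have JI x : J x -> I x.
  move=> [k]; apply: span_sub => // y; elim: k => //= k IHk.
  by rewrite inE => /predU1P[->|/IHk].
have [k] := minI sJ nfJ JI (gI 0%N).
elim: k => [|k IHk]; first exact: (gL 0%N).
move=> [c cL].
(* The top coefficient c either kills I, and then the shorter list already spans g 0, or acts
   invertibly on I, and then g (k+1) depends on the earlier elements. *)
case: (pselect (forall x, I x -> c * x = 0)) => [c0|/minimal_inv[b bE]].
  by apply: IHk; move: cL; rewrite -[c *: _]/(c * _) c0 // subr0.
apply: (gL k.+1); rewrite LE; apply/span_cat.
exists (- (b *: (g 0%N - c *: g k.+1))).
  have [_ _ Z] := span_submod (L' k); rewrite -scaleNr; exact: Z.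
exists b; rewrite /= opprK scalerBr -[b *: (c *: _)]/(b * (c * _)) -bE //.
by rewrite [g k.+1 + _]addrC subrK subrr.
Qed.

End MinimalNotFg.

Lemma artinian_ideal_fg (I : R^o -> Prop) : submod_pred I -> fg_pred I.
Proof.
move=> sI; apply: contrapT => nfI.
have [J [sJ nfJ minJ]] := artinian_minimal (F := fun J => ~ fg_pred J) sI nfI.
exact: minimal_absurd minJ.
Qed.

(** T relates an element of N to its possible coefficients at a; these need not be unique, hence a
    relation. The coefficients form an ideal of R, and the kernel of T lies in the span of the
    shorter list. *)
Lemma artinian_submod_fg (V : lmodType R) (s : seq V) (N : V -> Prop) :
  submod_pred N -> (forall x, N x -> span s x) -> fg_pred N.
Proof.
elim: s N => [|a s IHs] N sN Ns.
  by exists [::] => x; split=> [/Ns//|->]; have [] := sN.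
have [N0 ND NZ] := sN; have [s0 sD sZ] := span_submod s.
pose T x (r : R^o) := N x /\ span s (x - r *: a).
have T0 : T 0 0 by split; rewrite // scale0r subr0.
have TD x x' y y' : T x y -> T x' y' -> T (x + x') (y + y').
  move=> [Nx sx] [Nx' sx']; split; first exact: ND.
  by rewrite scalerDl opprD addrACA; apply: sD.
have TZ b x y : T x y -> T (b *: x) (b *: y).
  move=> [Nx sx]; split; first exact: NZ.
  by rewrite -[b *: y]/(b * y) -scalerA -scalerBr; apply: sZ.
have [||t tP] := fg_pred_ext T0 TD TZ.
- apply: artinian_ideal_fg; split; first by exists 0.
    by move=> u v [x xu] [y yv]; exists (x + y); apply: TD.
  by move=> b u [x xu]; exists (b *: x); apply: TZ.
- apply: IHs => [|x [_]]; last by rewrite scale0r subr0.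
  split=> //; first by move=> x y Tx Ty; rewrite -(addr0 0); apply: TD.
  by move=> b x Tx; rewrite -(scaler0 _ b); apply: TZ.
exists t => x; rewrite -tP; split=> [Nx|[r []//]].
by have [r sx] := Ns _ Nx; exists r.
Qed.

End Artinian.

Section Restriction.
Variables (R : comPzRingType) (S : pzRingType) (iota : {rmorphism R -> S}).

(** A copy of M tagged with the ring morphism, so that its R-module structure does not clash with
    the S-module structure. *)
Definition restrict of {rmorphism R -> S} := fun M : lmodType S => M : Type.

Variable M : lmodType S.
HB.instance Definition _ := GRing.Zmodule.on (restrict iota M).

Definition restrict_scale (r : R) (x : restrict iota M) : restrict iota M :=
  iota r *: (x : M).

Lemma restrict_scaleA a b x :
  restrict_scale a (restrict_scale b x) = restrict_scale (a * b) x.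
Proof. by rewrite /restrict_scale rmorphM scalerA. Qed.

Lemma restrict_scale1 : left_id 1 restrict_scale.
Proof. by move=> x; rewrite /restrict_scale rmorph1 scale1r. Qed.

Lemma restrict_scaleDr : right_distributive restrict_scale +%R.
Proof. by move=> a x y; rewrite /restrict_scale scalerDr. Qed.

Lemma restrict_scaleDl x : {morph restrict_scale^~ x : a b / a + b}.
Proof. by move=> a b; rewrite /restrict_scale rmorphD scalerDl. Qed.

HB.instance Definition _ := GRing.Zmodule_isLmodule.Build R (restrict iota M)
  restrict_scaleA restrict_scale1 restrict_scaleDr restrict_scaleDl.
End Restriction.

Definition noetherian (S : pzRingType) :=
  forall (X Y : lmodType S) (f : {linear X -> Y}), injective f ->
    fingen Y -> fingen X.

(** The products b_i e_j generate Y over R, so the image of X is finitely generated over R, and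
    generators over R generate over S. *)
Lemma artinian_noetherian (R : comPzRingType) (S : pzRingType)
    (iota : {rmorphism R -> S}) :
  artinian R -> fingen (restrict iota S^o : lmodType R) -> noetherian S.
Proof.
move=> artR [l [b bP]] X Y f fi [k [e eP]].
pose s : seq (restrict iota Y) := [seq (b i : S) *: (e j : Y) | i <- enum 'I_l,
  j <- enum 'I_k].
have sP y : span s y.
  have [c ->] := eP y; have [s0 sD sZ] := span_submod s.
  apply: (big_ind (span s)) => // j _; have [d dE] := bP (c j).
  have -> : c j = \sum_i iota (d i) * b i := dE.
  rewrite scaler_suml; apply: (big_ind (span s)) => // i _.
  rewrite -scalerA; apply: (sZ (d i)); apply/span_mem/allpairsP.
  by exists (i, j); rewrite !mem_enum.
have [t tP] : fg_pred (fun y : restrict iota Y => exists x, f x = y).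
  apply: (artinian_submod_fg artR (s := s)) => [|y _]; last exact: sP.
  split; first by exists 0; rewrite linear0.
    by move=> x y [u <-] [v <-]; exists (u + v); rewrite linearD.
  by move=> a x [u <-]; exists (iota a *: u); rewrite linearZ.
have /choice[g gP] : forall i : 'I_(size t), exists x, f x = nth 0 t i.
  by move=> i; apply/tP/span_mem/mem_nth.
exists (size t), g => x.
have tfx : span t (f x) by apply/tP; exists x.
pose N (y : restrict iota Y) := exists c : 'I_(size t) -> S,
  y = f (\sum_i c i *: g i).
have [||c /fi //] := span_sub (N := N) _ _ tfx; last by exists c.
  split; first by exists (fun=> 0); rewrite big1 ?linear0 // => i _;
    rewrite scale0r.
    move=> y z [c ->] [d ->]; exists (fun i => c i + d i).
    by rewrite -linearD -big_split; congr (f _); apply: eq_bigr => i _;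
      rewrite scalerDl.
  move=> a y [c ->]; exists (fun i => iota a * c i).
  rewrite -[LHS]/(iota a *: f _) -linearZ scaler_sumr; congr (f _).
  by apply: eq_bigr => i _; rewrite scalerA.
move=> y /(nthP 0)[i it <-]; pose j := Ordinal it.
exists (fun i => (i == j)%:R); rewrite -[LHS](gP j) (bigD1 j) //= eqxx scale1r.
by rewrite big1 ?addr0 // => h /negbTE->; rewrite scale0r.
Qed.

(** * Duality *)

Lemma noetherian_lker (T : pzRingType) (X Y : lmodType T) (f : {linear X -> Y})
  :
  noetherian T -> fingen X -> fingen (lker f).
Proof.
by move=> noeT; apply: (noeT _ _ (lker_incl f));
  apply: (@val_inj _ _ (lker_type f)).
Qed.

Lemma noetherian_cover (T : pzRingType) (X Y : lmodType T) (f : {linear X ->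
  Y}) :
  noetherian T -> fingen X ->
  exists n (D : {linear 'rV[T]_n -> X}), exact D f.
Proof.
move=> noeT fX.
have [n [g gs]] := fingen_cover (@noetherian_lker _ _ _ f noeT fX).
exists n, (lker_incl f \o g : {linear _ -> _}) => y; split=> [fy|[x <-]].
  have yP : y \in lker_pred f by rewrite inE fy.
  by have [x xE] := gs (exist _ y yP : lker_type f); exists x; rewrite /= xE.
exact: lker_inclP.
Qed.

Section Pairing.
Variable L : pzRingType.
Notation S := (L^c : pzRingType).

(* The perfect pairing between the left module S^n over S = L^c and the left
   module L^n over L, i.e. between a free right L-module and its dual. *)
Definition pair n (x : 'rV[S]_n) (v : 'rV[L]_n) : L :=
  \sum_i v 0 i * (x 0 i : L).

Lemma pair_linearl n (v : 'rV[L]_n) : linear (fun x => pair x v : S^o).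
Proof.
move=> a x y; rewrite -[RHS]/(pair x v * (a : L) + pair y v)
  mulr_suml -big_split.
by apply: eq_bigr => i _; rewrite !mxE /= -mulrA -mulrDr.
Qed.

Lemma pair_linearr n (x : 'rV[S]_n) : linear (fun v => pair x v : L^o).
Proof.
move=> a u v; rewrite -[RHS]/(a * pair x u + pair x v) mulr_sumr -big_split.
by apply: eq_bigr => i _; rewrite !mxE /= mulrA -mulrDl.
Qed.

Definition pairl n v : {linear 'rV[S]_n -> S^o} :=
  to_linear (@pair_linearl n v).
Definition pairr n x : {linear 'rV[L]_n -> L^o} :=
  to_linear (@pair_linearr n x).

Lemma pair_deltal n (v : 'rV[L]_n) i : pair (delta_mx 0 i) v = v 0 i.
Proof.
rewrite /pair (bigD1 i) //= !mxE !eqxx big1 ?addr0 ?mulr1 //.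
by move=> j /negbTE ji; rewrite !mxE ji andbF mulr0.
Qed.

Lemma pair_deltar n (x : 'rV[S]_n) i : pair x (delta_mx 0 i) = x 0 i.
Proof.
rewrite /pair (bigD1 i) //= !mxE !eqxx big1 ?addr0 ?mul1r //.
by move=> j /negbTE ji; rewrite !mxE ji andbF mul0r.
Qed.

Lemma pair_injr n (u v : 'rV[L]_n) : (forall x, pair x u = pair x v) -> u = v.
Proof. by move=> E; apply/rowP => i; rewrite -!pair_deltal. Qed.

Lemma pair_injl n (x y : 'rV[S]_n) : (forall v, pair x v = pair y v) -> x = y.
Proof. by move=> E; apply/rowP => i; rewrite -!pair_deltar. Qed.

Lemma pairl_surj n (f : {linear 'rV[S]_n -> S^o}) :
  exists v, forall x, f x = pair x v.
Proof.
exists (\row_i f (delta_mx 0 i)) => x; rewrite {1}[x]row_sum_delta linear_sum.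
by apply: eq_bigr => i _; rewrite linearZ mxE.
Qed.

Lemma pairr_surj n (f : {linear 'rV[L]_n -> L^o}) :
  exists x, forall v, f v = pair x v.
Proof.
exists (\row_i f (delta_mx 0 i)) => v; rewrite {1}[v]row_sum_delta linear_sum.
by apply: eq_bigr => i _; rewrite linearZ mxE.
Qed.

Lemma adjointl m n (D : {linear 'rV[S]_m -> 'rV[S]_n}) :
  exists D' : {linear 'rV[L]_n -> 'rV[L]_m},
    forall x v, pair (D x) v = pair x (D' v).
Proof.
have lin : linear (fun v => \row_i pair (D (delta_mx 0 i)) v : 'rV[L]_m).
  by move=> a u v; apply/rowP => i; rewrite !mxE; apply: pair_linearr.
exists (to_linear lin) => x v.
have [w wE] := pairl_surj (pairl v \o D : {linear _ -> _}).
rewrite [LHS]wE; congr (pair x _); apply/rowP => i.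
by rewrite mxE -[RHS]/((pairl v \o D) _) wE pair_deltal.
Qed.

Lemma adjointr m n (D : {linear 'rV[L]_m -> 'rV[L]_n}) :
  exists D' : {linear 'rV[S]_n -> 'rV[S]_m},
    forall x v, pair x (D v) = pair (D' x) v.
Proof.
have lin : linear (fun x => \row_i pair x (D (delta_mx 0 i)) : 'rV[S]_m).
  by move=> a x y; apply/rowP => i; rewrite !mxE; apply: pair_linearl.
exists (to_linear lin) => x v.
have [y yE] := pairr_surj (pairr x \o D : {linear _ -> _}).
rewrite [LHS]yE; congr (pair _ v); apply/rowP => i.
by rewrite mxE -[RHS]/((pairr x \o D) _) yE pair_deltar.
Qed.

Section Duality.
Hypotheses (noeS : noetherian S) (noeL : noetherian L).
Hypothesis injL : finite_injdim (L^o : lmodType L).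
Implicit Types X : lmodType S.

(* Adjoint of the differential of a presentation P1 -> P0 -> X; its kernel is
   the dual X^* and its cokernel the transpose of X. *)
Definition presents m n (D : {linear 'rV[S]_m -> 'rV[S]_n})
    (D' : {linear 'rV[L]_n -> 'rV[L]_m}) X (e : {linear 'rV[S]_n -> X}) :=
  [/\ surj e, exact D e & forall x v, pair (D x) v = pair x (D' v)].

(** The syzygy X1 of X is covered by the same S^m, and [lker D2'] is its dual. Surjectivity of p,
    from the dual of S^n to the dual of X1, is Ext^1(X, S) = 0. *)
Lemma presents_next X m n D D' e : @presents m n D D' X e -> perp X ->
  exists l (D2 : {linear 'rV[S]_l -> 'rV[S]_m}) D2' (X1 : lmodType S)
      (e1 : {linear 'rV[S]_m -> X1}) (p : {linear 'rV[L]_n -> lker D2'}),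
    [/\ presents D2 D2' e1, perp X1, short_exact (lker_incl D') p &
        forall v, lker_incl D2' (p v) = D' v].
Proof.
move=> [es De DD'] [fX eX]; have se := short_exact_lker es.
have [|q qE] := short_exact_lift (h := D) se.
  by move=> x; apply: (exact0 _ De).
have [fi _ _] := se.
have qs : surj q.
  move=> z; have /De[x xE] := lker_inclP e z.
  by exists x; apply: fi; rewrite qE.
have [l [D2 D2q]] := noetherian_cover q noeS (rV_fingen S m).
have [D2' D2D2'] := adjointl D2.
have pX1 : perp (lker e).
  split=> [|k]; first exact: fingen_surj qs (rV_fingen S m).
  exact: (eX k.+1 _ _ _ _ (@rV_projective S n) se).
have i2 : injective (lker_incl D2') by apply: (@val_inj _ _ (lker_type D2')).
have [|p pE] := linear_factor_inj (h := D') i2.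
  move=> v; have vP : D' v \in lker_pred D2'.
    rewrite inE; apply/eqP/pair_injr => x; rewrite -D2D2' -DD' -qE.
    by rewrite (exact0 _ D2q) !linear0 [LHS](linear0 (pairl v))
      [RHS](linear0 (pairr x)).
  by exists (exist _ (D' v) vP : lker_type D2').
exists l, D2, D2', (lker e), q, p; split=> //; split=> //.
  move=> v; split=> [pv|[w <-]].
    have vP : v \in lker_pred D' by rewrite inE -pE pv linear0.
    by exists (exist _ v vP : lker_type D').
  by apply: i2; rewrite pE linear0; apply: lker_inclP.
move=> w; have D2w := lker_inclP D2' w; set v := lker_incl D2' w in D2w.
have [|t tE] := linear_factor_surj (f := pairl v) qs.
  move=> x qx; have /D2q[y <-] := qx.
  by rewrite /= D2D2' D2w; apply: (linear0 (pairr y)).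
have [s sE] := eX 0%N _ _ _ _ (@rV_projective _ _) se t.
have [u uE] := pairl_surj s; exists u; apply: i2; rewrite pE.
by apply: pair_injr => x; rewrite -DD' -uE -qE -sE -tE.
Qed.

(* The sequences 0 -> X^* -> P0^* -> (Omega X)^* -> 0 exhibit X^* as a j-th
   syzygy for every j. *)
Lemma dual_perp X m n D D' e k :
  @presents m n D D' X e -> perp X -> ext k (lker D' : lmodType L) L^o.
Proof.
have [d dP] := finite_injdim_ext injL.
suff H j : forall X m n D D' e k, @presents m n D D' X e -> perp X ->
    (d <= k + j)%N -> ext k (lker D' : lmodType L) L^o.
  by move=> pr pX; apply: (H d) pr pX _; apply: leq_addl.
elim: j => [|j IHj] {m n}X m n {}D {}D' {}e {}k pr pX dk.
  by apply: dP; rewrite -(addn0 k).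
have [l [D2 [D2' [X1 [e1 [p [pr1 pX1 se _]]]]]]] := presents_next pr pX.
have dk1 : (d <= k.+1 + j)%N by rewrite addSnnS.
exact: (IHj _ _ _ _ _ _ k.+1 pr1 pX1 dk1 _ _ _ _ (@rV_projective L n) se).
Qed.

(* Splice the presentation of X with the dual of a resolution of X^*. *)
Lemma perp_embedding X : perp X ->
  exists n (X' : lmodType S) (f : {linear X -> 'rV[S]_n})
      (g : {linear 'rV[S]_n -> X'}), short_exact f g /\ perp X'.
Proof.
move=> pX; have [fX eX] := pX.
have [n [e es]] := fingen_cover fX.
have [m [D De]] := noetherian_cover e noeS (rV_fingen S n).
have [D' DD'] := adjointl D.
have pr : presents D D' e by [].
(* Two more presentations are taken because exactness of the dualised splice at its three spots uses
   Ext^1(-, L) = 0 for X2^*, X1^* and X^*: in [ker_c], [ker_F1] and [gs] respectively. *)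
have [l [D2 [D2' [X1 [e1 [p1 [pr1 pX1 se1 pE1]]]]]]] := presents_next pr pX.
have [l3 [D3 [D3' [X2 [e2 [p2 [pr2 pX2 se2 pE2]]]]]]] := presents_next pr1 pX1.
have fK : fingen (lker D') by apply: noetherian_lker => //; apply: rV_fingen.
have [q0 [E0 E0s]] := fingen_cover fK.
have [q1 [E1 E1E0]] := noetherian_cover E0 noeL (rV_fingen L q0).
have [q2 [E2 E2E1]] := noetherian_cover E1 noeL (rV_fingen L q1).
(* c covers the dual of X inside the dual of S^n; its adjoint c' has the image of D as kernel and so
   induces the embedding f. *)
pose c : {linear 'rV[L]_q0 -> 'rV[L]_n} := lker_incl D' \o E0.
have cE v : c v = lker_incl D' (E0 v) by [].
have [c' cc'] := adjointr c.
have [F1 F1P] := adjointr E1.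
have [F2 F2P] := adjointr E2.
have ker_c x : c' x = 0 -> exists y, D y = x.
  move=> cx.
  have [|t tE] := short_exact_desc (h := pairr x) se1.
    move=> w; have [v <-] := E0s w; rewrite -[LHS]/(pair x (c v)) cc' cx.
    exact: (linear0 (pairl v)).
  have [s sE] := dual_perp 0%N pr2 pX2 _ _ _ _ (@rV_projective L m) se2 t.
  have [y yE] := pairr_surj s; exists y; apply: pair_injl => v.
  by rewrite DD' -yE -pE1 -sE -tE.
have Dc y : c' (D y) = 0.
  apply: pair_injl => v; rewrite -cc' DD' cE lker_inclP.
  by rewrite [LHS](linear0 (pairr y)) [RHS](linear0 (pairl v)).
have [|f fE] := linear_factor_surj (f := c') es.
  by move=> x /De[y <-]; apply: Dc.
have F1c x : F1 (c' x) = 0.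
  apply: pair_injl => v; rewrite -F1P -cc' cE (exact0 _ E1E0) linear0.
  by rewrite [LHS](linear0 (pairr x)) [RHS](linear0 (pairl v)).
have ker_F1 z : F1 z = 0 -> exists x, c' x = z.
  move=> Fz.
  have [|t tE] := linear_factor_surj (f := pairr z) E0s.
    by move=> v /E1E0[w <-]; rewrite /= F1P Fz; apply: (linear0 (pairl w)).
  have [s sE] := dual_perp 0%N pr1 pX1 _ _ _ _ (@rV_projective L n) se1 t.
  have [x xE] := pairr_surj s; exists x; apply: pair_injl => v.
  by rewrite -cc' -xE -sE -tE.
have i2 : injective (lker_incl F2) by apply: (@val_inj _ _ (lker_type F2)).
have [|g gE] := linear_factor_inj (h := F1) i2.
  move=> z; have zP : F1 z \in lker_pred F2.
    rewrite inE; apply/eqP/pair_injl => v; rewrite -F2P -F1P (exact0 _ E2E1).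
    by rewrite [LHS](linear0 (pairr z)) [RHS](linear0 (pairl v)).
  by exists (exist _ (F1 z) zP : lker_type F2).
have gs : surj g.
  move=> w; have F2w := lker_inclP F2 w.
  have se0 := short_exact_lker E0s.
  have [|r rE] := short_exact_lift (h := E1) se0.
    by move=> v; apply: (exact0 _ E1E0).
  have [i0 _ _] := se0.
  have rs : surj r.
    move=> v; have /E1E0[u uE] := lker_inclP E0 v.
    by exists u; apply: i0; rewrite rE.
  have [|t tE] := linear_factor_surj (f := pairr (lker_incl F2 w)) rs.
    move=> v rv; have /E2E1[u <-] : E1 v = 0 by rewrite -rE rv linear0.
    by rewrite /= F2P F2w; apply: (linear0 (pairl u)).
  have [s sE] := dual_perp 0%N pr pX _ _ _ _ (@rV_projective L q0) se0 t.
  have [z zE] := pairr_surj s; exists z; apply: i2; rewrite gE.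
  by apply: pair_injl => v; rewrite -F1P -zE -rE -sE -tE.
have fg : short_exact f g.
  split=> //.
  - have f0 x : f x = 0 -> x = 0.
      have [y <-] := es x; rewrite -fE => /ker_c[z <-].
      exact: (exact0 _ De).
    exact: raddf_inj f0.
  - move=> z; split=> [gz|[x <-]].
      have [|x <-] := ker_F1 z; first by rewrite -gE gz linear0.
      by exists (e x); rewrite -fE.
    have [y <-] := es x; apply: i2; rewrite gE -fE linear0; exact: F1c.
exists q0, (lker F2), f, g; split=> //; split=> [|[|k]].
- exact: fingen_surj gs (rV_fingen S q0).
(* A map X -> S is an element of the dual of X, hence the image under E0 of some v; pairing with v
   extends it along f. *)
- apply: (ext0_syzygy (@rV_projective S q0) fg) => u.
  have [w wE] := pairl_surj (u \o e : {linear _ -> _}).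
  have wP : w \in lker_pred D'.
    rewrite inE; apply/eqP/pair_injr => x; rewrite -DD' -wE /=.
    by rewrite (exact0 _ De) linear0 [RHS](linear0 (pairr x)).
  have [v vE] := E0s (exist _ w wP : lker_type D').
  exists (pairl v) => x; have [y <-] := es x; rewrite -fE /= -cc' cE vE.
  exact: wE.
- exact: ext_syzygy (@rV_projective S q0) fg (eX k).
Qed.

End Duality.
End Pairing.

(** * Gorenstein projective modules *)

Section Complexes.
Variable S : pzRingType.
Implicit Types X Y Z K P Q : lmodType S.

Lemma to_cycles_linear (P : complex S) i j : linear (@to_cycles S P i j).
Proof. by move=> a x y; apply: val_inj; rewrite /= linearP. Qed.

Definition to_cyc (P : complex S) i j : {linear P i -> cycles P j} :=
  to_linear (@to_cycles_linear P i j).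

Definition cycles_incl (P : complex S) j : {linear cycles P j -> P j} :=
  lker_incl (cd P j (j + 1)).

Lemma to_cycK (P : complex S) i j x : cycles_incl P j (to_cyc P i j x)
  = cd P i j x.
Proof. by []. Qed.

Lemma cycles_incl_inj (P : complex S) j : injective (cycles_incl P j).
Proof. exact: (@val_inj _ _ (lker_type (cd P j (j + 1)))). Qed.

Lemma cycles_seq (P : complex S) i : acyclic P ->
  short_exact (cycles_incl P i) (to_cyc P i (i + 1)).
Proof.
move=> acP; have ci := @cycles_incl_inj P; split=> //.
- move=> y; split=> [/(congr1 (cycles_incl P (i + 1)))|[x <-]].
    rewrite to_cycK linear0 => dy.
    have yP : y \in lker_pred (cd P i (i + 1)) by rewrite inE dy.
    by exists (exist _ y yP : lker_type _).
  by apply: ci; rewrite to_cycK linear0; apply: lker_inclP.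
- move=> y; have dy := lker_inclP (cd P (i + 1) (i + 1 + 1)) y.
  have [+ _] := acP (i + 1) (cycles_incl P (i + 1) y).
  rewrite addrK => /(_ dy)[x xE]; exists x; apply: ci; rewrite -xE;
    exact: to_cycK.
Qed.

Lemma iso_lker X Y Z (f : {linear X -> Y}) (h : {linear Y -> Z}) :
  injective f -> exact f h -> iso X (lker h).
Proof.
move=> fi fh.
have ii : injective (lker_incl h) by apply: (@val_inj _ _ (lker_type h)).
have [|k kE] := linear_factor_inj (h := f) ii.
  move=> x; have xP : f x \in lker_pred h by rewrite inE (exact0 _ fh).
  by exists (exist _ (f x) xP : lker_type h).
have [|l lE] := linear_factor_inj (h := lker_incl h) fi.
  by move=> z; apply/fh; apply: lker_inclP.
exists k; exists l => x; first by apply: fi; rewrite lE kE.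
by apply: ii; rewrite kE lE.
Qed.

Section Splice.
Variables (Z : int -> lmodType S).
Record splice X Y := Splice {
  splice_ob : lmodType S;
  splice_in : {linear X -> splice_ob};
  splice_out : {linear splice_ob -> Y};
  splice_prj : prj splice_ob;
  splice_exact : short_exact splice_in splice_out
}.
Variable (M : forall i, splice (Z i) (Z (i + 1))).

Let P i := splice_ob (M i).
Let f i : {linear Z i -> P i} := splice_in (M i).
Let g i : {linear P i -> Z (i + 1)} := splice_out (M i).
Let fg i : short_exact (f i) (g i) := splice_exact (M i).
Let cast i j (e : i + 1 = j) : {linear P i -> Z j} :=
  eq_rect (i + 1) (fun k => {linear P i -> Z k}) (g i) j e.

(** A [complex] has a map for every pair of indices. Since i + 1 = j is decided and not
    definitional, the nonzero case passes through the transport [cast]. *)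
Definition splice_d i j : {linear P i -> P j} :=
  match i + 1 =P j with
  | ReflectT e => f j \o cast e
  | ReflectF _ => \0
  end.

Lemma splice_dE i x : splice_d i (i + 1) x = f (i + 1) (g i x).
Proof.
by rewrite /splice_d; case: eqP => // e; rewrite (eq_irrelevance e (erefl _)).
Qed.

Lemma splice_d_shape i j : j != i + 1 -> forall x, splice_d i j x = 0.
Proof. by rewrite /splice_d eq_sym; case: eqP. Qed.

Lemma splice_d_comp i j k x : splice_d j k (splice_d i j x) = 0.
Proof.
case: (eqVneq j (i + 1)) x => [-> x|/splice_d_shape H x];
  last by rewrite H linear0.
case: (eqVneq k (i + 1 + 1)) => [->|/splice_d_shape->//].
rewrite !splice_dE; have [_ fgE _] := fg (i + 1).
by rewrite (exact0 _ fgE) linear0.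
Qed.

Definition splice_complex : complex S := Complex splice_d_shape splice_d_comp.

Lemma splice_exact_at i y : splice_d i (i + 1) y = 0 <-> exists x, f i x = y.
Proof.
rewrite splice_dE; have [_ fgE _] := fg i; have [fi _ _] := fg (i + 1).
by rewrite -fgE; split=> [|->]; rewrite ?linear0 // -[RHS](linear0 (f (i + 1)))
  => /fi.
Qed.

Lemma splice_acyclic : acyclic splice_complex.
Proof.
move=> j; have -> : j = j - 1 + 1 by rewrite subrK.
move: (j - 1) => i {j}; rewrite addrK => y /=; rewrite splice_exact_at.
split=> [[x <-]|[x <-]]; last by exists (g i x); rewrite splice_dE.
by have [_ _ gs] := fg i; have [z <-] := gs x; exists z; rewrite splice_dE.
Qed.

Lemma splice_totally_acyclic :
  (forall i Q, projective Q -> ext 0 (Z i) Q) -> totally_acyclic splice_complex.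
Proof.
move=> eZ; split=> [j||Q pQ j]; [exact: splice_prj|exact: splice_acyclic|].
have -> : j = j - 1 + 1 by rewrite subrK.
move: (j - 1) => i {j}; rewrite addrK => psi psi0.
have [|t tE] := short_exact_desc (h := psi) (fg (i + 1)).
  move=> x; have [_ _ gs] := fg i; have [z <-] := gs x.
  by rewrite -splice_dE; apply: psi0.
have [u uE] := eZ _ Q pQ _ _ _ _ (splice_prj (M (i + 1 + 1))).2 (fg (i + 1 +
  1)) t.
exists u => x; rewrite tE uE; congr (u _); exact/esym/splice_dE.
Qed.

Lemma splice_cycles i : iso (Z i) (cycles splice_complex i).
Proof.
apply: (@iso_lker _ _ _ (f i)); first by have [] := fg i.
by move=> y; apply: splice_exact_at.
Qed.

End Splice.
End Complexes.

(** * Perpendicular modules and total acyclicity *)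

Section Perp.
Variable S : pzRingType.
Hypothesis noeS : noetherian S.
Hypothesis perp_emb : forall X : lmodType S, perp X ->
  exists n (X' : lmodType S) (f : {linear X -> 'rV[S]_n})
      (g : {linear 'rV[S]_n -> X'}), short_exact f g /\ perp X'.
Implicit Types A B X Y Z K P Q W : lmodType S.

Lemma fingen_cover_seq X : fingen X ->
  exists K P (f : {linear K -> P}) (g : {linear P -> X}),
    [/\ prj P, short_exact f g & fingen K].
Proof.
move=> /fingen_cover[k [g gs]].
exists (lker g), 'rV[S]_k, (lker_incl g), g; split; first exact: rV_prj.
  exact: short_exact_lker.
exact: noetherian_lker (rV_fingen S k).
Qed.

Lemma ext_rV k X m : ext k X S^o -> ext k X 'rV[S]_m.
Proof.
elim: k X => [|k IHk] X eX K P f g pP fg; last exact: IHk (eX _ _ _ _ pP fg).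
move=> u.
have coord (i : 'I_m) : exists v : {linear P -> S^o}, forall x,
  u x 0 i = v (f x).
  have lin : linear (fun x => u x 0 i : S^o) by move=> a x y;
    rewrite linearP !mxE.
  by have [v vE] := eX _ _ _ _ pP fg (to_linear lin); exists v => x;
    rewrite -vE.
have [v vE] := choice coord.
have lin : linear (fun x => \row_i (v i x : S)).
  by move=> a x y; apply/rowP => i; rewrite !mxE linearP.
by exists (to_linear lin) => x; apply/rowP => i; rewrite /= mxE vE.
Qed.

Lemma perp_ext X Q k : perp X -> projective Q -> ext k X Q.
Proof.
move=> [fX eX] pQ; elim: k X fX eX => [|k IHk] X fX eX.
all: have [K [P [f [g [[fP pP] fg fK]]]]] := fingen_cover_seq fX.
  apply: (ext0_syzygy pP fg) => u.
  have [m [a [b ab]]] := projective_fingen_factor u fK pQ.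
  have [v vE] := @ext_rV 0 _ m (eX 0%N) _ _ _ _ pP fg a.
  by exists (b \o v : {linear _ -> _}) => x /=; rewrite -vE.
apply: (ext_syzygy pP fg); apply: IHk => // l.
exact: (eX l.+1 _ _ _ _ pP fg).
Qed.

Lemma perp_stable_retract X' X : fingen X' -> stable_retract X' X -> perp X ->
  perp X'.
Proof. by move=> fX' XX [fX eX]; split=> // k;
  apply: ext_stable_retract XX (eX k). Qed.

Lemma perp_prj P : prj P -> perp P.
Proof. by move=> [fP pP]; split=> // k; apply: ext_projective. Qed.

Lemma perp_kernel A B X (i : {linear A -> B}) (p : {linear B -> X}) :
  short_exact i p -> perp B -> perp X -> perp A.
Proof.
move=> ip [fB eB] [fX eX]; split=> [|k]; last exact: ext_kernel ip (eB k)
  (eX k.+1).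
by have [ii _ _] := ip; apply: noeS ii fB.
Qed.

Lemma perp_cosyzygy X : perp X ->
  exists Y P (f : {linear X -> P}) (g : {linear P -> Y}),
    [/\ prj P, short_exact f g & perp Y].
Proof.
move=> /perp_emb[n [Y [f [g [fg pY]]]]].
by exists Y, 'rV[S]_n, f, g; split=> //; apply: rV_prj.
Qed.

Lemma perp_syzygy X : perp X ->
  exists K P (f : {linear K -> P}) (g : {linear P -> X}),
    [/\ prj P, short_exact f g & perp K].
Proof.
move=> pX; have [K [P [f [g [pP fg fK]]]]] := fingen_cover_seq pX.1.
by exists K, P, f, g; split=> //; apply: perp_kernel fg (perp_prj pP) pX.
Qed.

Lemma perp_complex X : perp X ->
  exists P : complex S, totally_acyclic P /\ iso X (cycles P 0).
Proof.
move=> pX; pose T := {X : lmodType S | perp X}.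
have next (Y : T) : exists Y' : T, inhabited (splice (sval Y) (sval Y')).
  case: Y => Y pY; have [Z [P [f [g [pP fg pZ]]]]] := perp_cosyzygy pY.
  by exists (exist _ Z pZ); split; exists P f g.
have prev (Y : T) : exists Y' : T, inhabited (splice (sval Y') (sval Y)).
  case: Y => Y pY; have [Z [P [f [g [pP fg pZ]]]]] := perp_syzygy pY.
  by exists (exist _ Z pZ); split; exists P f g.
have [nx nxP] := choice next; have [pv pvP] := choice prev.
pose x0 : T := exist _ X pX.
pose Z i : T := match i with
  | Posz k => iter k nx x0 | Negz k => iter k.+1 pv x0 end.
have MZ i : splice (sval (Z i)) (sval (Z (i + 1))).
  apply: inhabited_witness; case: i => [k|[|k]].
  - by rewrite -PoszD addn1; apply: nxP.
  - exact: pvP.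
  - have -> : Negz k.+1 + 1 = Negz k; last exact: pvP.
    by rewrite !NegzE intS opprD addrAC addNr add0r.
exists (splice_complex MZ); split; last exact: (splice_cycles MZ 0).
by apply: splice_totally_acyclic => i Q pQ; apply: perp_ext => //; case: (Z i).
Qed.

(** Exactness of Hom(P, S) two places before j is Ext^1(Z^j, S) = 0, and higher Ext of Z^j is Ext^1
    of earlier cycles. *)
Lemma perp_cycles (P : complex S) j : totally_acyclic P -> perp (cycles P j).
Proof.
move=> [prjP acP homP].
have fcyc i : fingen (cycles P i).
  have -> : i = i - 1 + 1 by rewrite subrK.
  have [_ _ gs] := cycles_seq (i - 1) acP.
  exact: fingen_surj gs (prjP _).1.
split=> // k; elim: k j => [|k IHk] j.
  have -> : j = j - 1 - 1 + 1 + 1 by rewrite !subrK.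
  move: (j - 1 - 1) => i; apply: (ext0_syzygy (prjP _).2 (cycles_seq _ acP))
    => u.
  have pS : projective (S^o : lmodType S).
    move=> A B p q ps; have [a aE] := ps (q 1).
    have lin : linear (fun x : S^o => (x : S) *: a).
      by move=> b x y; rewrite scalerDl -scalerA.
    by exists (to_linear lin) => x; rewrite /= linearZ aE -linearZ;
      congr (q _); apply: mulr1.
  have [|v vE] := homP _ pS i (u \o to_cyc P i (i + 1) : {linear _ -> _}).
    move=> x; have c0 : to_cyc P i (i + 1) (cd P (i - 1) i x) = 0.
      by apply: cycles_incl_inj; rewrite to_cycK cd_comp linear0.
    by rewrite -[LHS]/(u (to_cyc P i (i + 1) (cd P (i - 1) i x))) c0 linear0.
  exists v => z; have [_ _ gs] := cycles_seq i acP; have [x <-] := gs z.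
  by rewrite to_cycK -vE.
have -> : j = j - 1 + 1 by rewrite subrK.
exact: ext_syzygy (prjP _).2 (cycles_seq _ acP) (IHk _).
Qed.

Lemma Gprj_perp X : Gprj X <-> perp X.
Proof.
split=> [[P [j [tP XP]]]|/perp_complex[P [tP XP]]]; last by exists P, 0.
apply: perp_stable_retract (iso_stable_retract XP) (perp_cycles j tP).
have [f [g fg gf]] := iso_sym XP.
by apply: fingen_surj (perp_cycles j tP).1 => x; exists (g x).
Qed.

End Perp.

(** * Syzygies and stable maps *)

Section StableMaps.
Variable S : pzRingType.
Implicit Types A B X Y Z K L P Q T M W : lmodType S.

(* h' represents the syzygy of h. *)
Definition syzygy_map K P X L Q Y (f : {linear K -> P}) (g : {linear P -> X})
    (i : {linear L -> Q}) (p : {linear Q -> Y})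
    (h' : {linear K -> L}) (h : {linear X -> Y}) :=
  exists H : {linear P -> Q},
    (forall x, H (f x) = i (h' x)) /\ (forall y, p (H y) = h (g y)).

Lemma factors_prj_ext X Y (h k : X -> Y) :
  (forall x, h x = k x) -> factors_prj h -> factors_prj k.
Proof. by move=> hk [P [a [b [pP E]]]]; exists P, a, b; split=> // x;
  rewrite -hk. Qed.

Section Step.
Variables (K P X L Q Y : lmodType S).
Variables (f : {linear K -> P}) (g : {linear P -> X}).
Variables (i : {linear L -> Q}) (p : {linear Q -> Y}).
Hypotheses (fg : short_exact f g) (ip : short_exact i p).

Lemma syzygy_map_exists (h : {linear X -> Y}) : projective P ->
  exists h' : {linear K -> L}, syzygy_map f g i p h' h.
Proof.
move=> pP; have [fi fgE gs] := fg; have [ii ipE ps] := ip.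
have [H HE] := pP _ _ p (h \o g : {linear _ -> _}) ps.
have [|h' hE] := short_exact_lift (h := H \o f : {linear _ -> _}) ip.
  by move=> x /=; rewrite HE /= (exact0 _ fgE) linear0.
by exists h', H; split=> x; rewrite ?hE ?HE.
Qed.

Lemma cosyzygy_map_exists (h' : {linear K -> L}) : projective P -> ext 0 X Q ->
  exists h : {linear X -> Y}, syzygy_map f g i p h' h.
Proof.
move=> pP eX; have [fi fgE gs] := fg; have [ii ipE ps] := ip.
have [H HE] := eX _ _ _ _ pP fg (i \o h' : {linear _ -> _}).
have [|h hE] := short_exact_desc (h := p \o H : {linear _ -> _}) fg.
  by move=> x /=; rewrite -HE /= (exact0 _ ipE).
by exists h, H; split=> x; rewrite -?HE -?hE.
Qed.

(** Lift the second factor of h to U along p. Then H - U v g takes values in L and restricts to h'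
    on K, so h' factors through P. *)
Lemma syzygy_map_factors (h' : {linear K -> L}) (h : {linear X -> Y}) : prj P ->
  syzygy_map f g i p h' h -> factors_prj h -> factors_prj h'.
Proof.
move=> pP [H [Hf Hg]] [T [v [u [[_ pT] E]]]].
have [fi fgE gs] := fg; have [ii ipE ps] := ip.
have [U UE] := pT _ _ p u ps.
have [|w wE] := short_exact_lift (h := H \- (U \o (v \o g)) : {linear _ -> _})
  ip.
  by move=> x; rewrite /= linearB Hg UE E subrr.
exists P, f, w; split=> // x; apply: ii.
by rewrite wE /= Hf (exact0 _ fgE) !linear0 addr0.
Qed.

Lemma cosyzygy_map_factors (h' : {linear K -> L}) (h : {linear X -> Y}) :
  projective P -> prj Q -> (forall T, projective T -> ext 0 X T) ->
  syzygy_map f g i p h' h -> factors_prj h' -> factors_prj h.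
Proof.
move=> pP pQ eX [H [Hf Hg]] [T [v [u [[_ pT] E]]]].
have [fi fgE gs] := fg; have [ii ipE ps] := ip.
have [V VE] := eX T pT _ _ _ _ pP fg v.
have [|w wE] := short_exact_desc (h := H \- (i \o (u \o V)) : {linear _ -> _})
  fg.
  by move=> x; rewrite /= Hf -VE -E subrr.
exists Q, w, p; split=> // x; have [y <-] := gs x.
by rewrite -wE /= linearB Hg (exact0 _ ipE) subr0.
Qed.

Lemma stable_Hom_vanish_syzygy : prj P -> prj Q ->
  (forall T, projective T -> ext 0 X T) ->
  stable_Hom_vanish X Y <-> stable_Hom_vanish K L.
Proof.
have zero A B (h : {linear A -> B}) : stable_eq h (fun=> 0) <-> factors_prj h.
  by split; apply: factors_prj_ext => x; rewrite subr0.
move=> pP pQ eX; split=> sh h; apply/zero.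
  have [k kh] := cosyzygy_map_exists h pP.2 (eX Q pQ.2).
  exact: (syzygy_map_factors pP kh ((zero _ _ _).1 (sh k))).
have [k kh] := syzygy_map_exists h pP.2.
exact: (cosyzygy_map_factors pP.2 pQ eX kh ((zero _ _ _).1 (sh k))).
Qed.

End Step.

(** A map K -> Y through a projective T extends to P because Ext^1(X, T) = 0, so stable maps out of
    the syzygy are Ext^1. *)
Lemma stable_Hom_vanish_ext K P X Y (f : {linear K -> P}) (g : {linear P -> X})
  :
  short_exact f g -> prj P -> (forall T, projective T -> ext 0 X T) ->
  stable_Hom_vanish K Y <-> ext 0 X Y.
Proof.
move=> fg pP eX; split=> [sh|eXY h].
  apply: (ext0_syzygy pP.2 fg) => u; have [T [a [b [[_ pT] E]]]] := sh u.
  have [v vE] := eX T pT _ _ _ _ pP.2 fg a.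
  by exists (b \o v : {linear _ -> _}) => x; rewrite /= -vE -E subr0.
have [v vE] := eXY _ _ _ _ pP.2 fg h.
by exists P, f, v; split=> // x; rewrite subr0 vE.
Qed.

(** A relation, since syzygies are unique only up to projective summands; the shifting lemmas then
    apply to whichever syzygy is at hand. *)
Fixpoint syz (k : nat) K X : Prop :=
  if k is l.+1 then
    exists Y P (f : {linear K -> P}) (g : {linear P -> Y}),
      [/\ prj P, short_exact f g & syz l Y X]
  else K = X.

Lemma syz_cat k l X Y Z : syz k X Y -> syz l Y Z -> syz (k + l) X Z.
Proof.
elim: k X => [|k IHk] X; first by move=> <-.
move=> [W [P [f [g [pP fg sW]]]]] sY; exists W, P, f, g; split=> //; exact: IHk.
Qed.

Lemma ext_syz m k K X Y : syz m K X -> ext (k + m) X Y <-> ext k K Y.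
Proof.
elim: m k K => [|m IHm] k K; first by move=> ->; rewrite addn0.
move=> [W [P [f [g [pP fg sW]]]]]; rewrite addnS -addSn (IHm _ _ sW).
by split=> [eW|]; [apply: eW pP.2 fg|apply: ext_syzygy pP.2 fg].
Qed.

Lemma ext_syz_right m k X L Y : (forall T l, projective T -> ext l X T) ->
  syz m L Y -> ext (k + m) X L <-> ext k X Y.
Proof.
move=> eX; elim: m k L => [|m IHm] k L; first by move=> ->; rewrite addn0.
move=> [W [P [f [g [[_ pP] fg sW]]]]]; rewrite -(IHm _ _ sW) addnS.
split=> [eL|eW]; first by apply: (ext_quotient fg) eL; apply: eX.
by apply: (ext_sub fg) eW _; apply: eX.
Qed.

End StableMaps.

(** * Iterated syzygies and approximations modulo projectives *)

Section SyzygyChains.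
Variable S : pzRingType.
Hypothesis noeS : noetherian S.
Hypothesis perp_emb : forall X : lmodType S, perp X ->
  exists n (X' : lmodType S) (f : {linear X -> 'rV[S]_n})
      (g : {linear 'rV[S]_n -> X'}), short_exact f g /\ perp X'.
Implicit Types A B X Y Z K L P Q T M W : lmodType S.

Lemma syz_exists m X : fingen X -> exists K, syz m K X /\ fingen K.
Proof.
move=> fX; elim: m => [|m [Y [sY fY]]]; first by exists X.
have [K [P [f [g [pP fg fK]]]]] := fingen_cover_seq noeS fY.
by exists K; split=> //; exists Y, P, f, g.
Qed.

Lemma cosyz_exists m K : perp K -> exists X, syz m K X /\ perp X.
Proof.
elim: m K => [|m IHm] K pK; first by exists K.
have [Y [P [f [g [pP fg pY]]]]] := perp_cosyzygy perp_emb pK.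
have [X [sX pX]] := IHm _ pY.
by exists X; split=> //; exists Y, P, f, g.
Qed.

Lemma perp_syz m K X : syz m K X -> perp X -> perp K.
Proof.
elim: m K => [|m IHm] K; first by move=> ->.
move=> [Y [P [f [g [pP fg sY]]]]] /(IHm _ sY) pY.
exact: (perp_kernel noeS fg (perp_prj pP) pY).
Qed.

Lemma perp_ext0 X T : perp X -> projective T -> ext 0 X T.
Proof. exact: (perp_ext noeS 0). Qed.

Lemma stable_Hom_vanish_syz m X Y K L : perp X -> syz m K X -> syz m L Y ->
  stable_Hom_vanish X Y <-> stable_Hom_vanish K L.
Proof.
move=> pX; elim: m K L => [|m IHm] K L; first by move=> -> ->.
move=> [A [P [f [g [pP fg sA]]]]] [B [Q [i [p [pQ ip sB]]]]].
rewrite (IHm _ _ sA sB); apply: (stable_Hom_vanish_syzygy fg ip pP pQ).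
by move=> T; apply: perp_ext0; apply: perp_syz sA pX.
Qed.

(** A is not asked to lie in F: it will come from C, while the test modules are also
    perpendicular. *)
Definition right_stable_approx (F : lmodType S -> Prop) A X (f : {linear A ->
  X}) :=
  forall M (g : {linear M -> X}), F M ->
    exists h : {linear M -> A}, factors_prj (fun x => g x - f (h x)).

Definition left_stable_approx (F : lmodType S -> Prop) X A (f : {linear X ->
  A}) :=
  forall M (g : {linear X -> M}), F M ->
    exists h : {linear A -> M}, factors_prj (fun x => g x - h (f x)).

(** A test map is moved up one syzygy at a time, which is possible because its source is
    perpendicular, then approximated and brought down. The remaining error is the syzygy of a map
    through a projective. *)
Lemma right_stable_approx_syz (F : lmodType S -> Prop)
  m X Y A (f : {linear A -> Y}) :
  (forall M, F M -> perp M) -> fingen A -> right_stable_approx F f ->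
    syz m X Y ->
  exists B (f' : {linear B -> X}), [/\ fingen B, syz m B A &
    right_stable_approx (fun K => exists2 M, F M & syz m K M) f'].
Proof.
move=> Fp fA rf; elim: m X => [|m IHm] X /=.
  move=> ->; exists A, f; split=> // M g [W FW /= E].
  by apply: rf; rewrite E.
move=> [Z [Q [i [p [pQ ip sZ]]]]].
have [B [k [fB sB rk]]] := IHm _ sZ.
have [C [P [j [q [pP jq fC]]]]] := fingen_cover_seq noeS fB.
have [f' [H [Hj Hq]]] := syzygy_map_exists jq ip k pP.2.
exists C, f'; split=> //; first by exists B, P, j, q.
move=> M g [W FW [M1 [P1 [j1 [q1 [pP1 jq1 sM1]]]]]].
have pM1 : perp M1 by apply: perp_syz sM1 (Fp _ FW).
have [G [G1 [Gj Gq]]] := cosyzygy_map_exists jq1 ip g pP1.2 (perp_ext0 pM1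
  pQ.2).
have [h hP] := rk _ G (ex_intro2 _ _ W FW sM1).
have [h' [H' [Hj' Hq']]] := syzygy_map_exists jq1 jq h pP1.2.
exists h'.
apply: (@syzygy_map_factors _ _ _ _ _ _ _ _ _ _ _ jq1 ip
  (g \- (f' \o h') : {linear _ -> _}) (G \- (k \o h) : {linear _ -> _})
    pP1 _ hP).
exists (G1 \- (H \o H') : {linear _ -> _}); split=> x /=.
  by rewrite linearB Gj Hj' Hj.
by rewrite linearB Gq Hq Hq'.
Qed.

(** Here the maps moved up start at X, so Y has to be perpendicular. *)
Lemma left_stable_approx_syz (F : lmodType S -> Prop) m X Y A (f : {linear Y ->
  A}) :
  perp Y -> fingen A -> left_stable_approx F f -> (forall M, F M -> perp M) ->
  syz m X Y ->
  exists B (f' : {linear X -> B}), [/\ fingen B, syz m B A &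
    left_stable_approx (fun K => exists2 M, F M & syz m K M) f'].
Proof.
move=> pY fA lf Fp; elim: m X => [|m IHm] X /=.
  move=> ->; exists A, f; split=> // M g [W FW /= E].
  by apply: lf; rewrite E.
move=> [Z [Q [i [p [pQ ip sZ]]]]].
have [B [k [fB sB lk]]] := IHm _ sZ.
have [C [P [j [q [pP jq fC]]]]] := fingen_cover_seq noeS fB.
have [f' [H [Hj Hq]]] := syzygy_map_exists ip jq k pQ.2.
exists C, f'; split=> //; first by exists B, P, j, q.
move=> M g [W FW [M1 [P1 [j1 [q1 [pP1 jq1 sM1]]]]]].
have pZ : perp Z by apply: perp_syz sZ pY.
have [G [G1 [Gj Gq]]] := cosyzygy_map_exists ip jq1 g pQ.2 (perp_ext0 pZ pP1.2).
have [h hP] := lk _ G (ex_intro2 _ _ W FW sM1).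
have [h' [H' [Hj' Hq']]] := syzygy_map_exists jq jq1 h pP.2.
exists h'.
apply: (@syzygy_map_factors _ _ _ _ _ _ _ _ _ _ _ ip jq1
  (g \- (h' \o f') : {linear _ -> _}) (G \- (h \o k) : {linear _ -> _})
    pQ _ hP).
exists (G1 \- (H' \o H) : {linear _ -> _}); split=> x /=.
  by rewrite linearB Gj Hj Hj'.
by rewrite linearB Gq Hq' Hq.
Qed.

End SyzygyChains.

(** * Cluster tilting *)

Section Main.
Variable S : pzRingType.
Hypothesis noeS : noetherian S.
Hypothesis perp_emb : forall X : lmodType S, perp X ->
  exists n (X' : lmodType S) (f : {linear X -> 'rV[S]_n})
      (g : {linear 'rV[S]_n -> X'}), short_exact f g /\ perp X'.
Variable d : nat.
Hypothesis extS : forall k (X : lmodType S), (d <= k)%N -> ext k X S^o.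
Variables (n : nat) (n_gt0 : (0 < n)%N) (C : lmodType S -> Prop).
Hypothesis Cct : nZ_cluster_tilting n C.
Implicit Types A X Y Z K L P Q W : lmodType S.

Lemma ct_fingen X : C X -> fingen X.
Proof. by case: Cct => -[H _ _ _] _; apply: H. Qed.

Lemma ct_leftE X : C X <->
  fingen X /\ forall k Y, (k.+1 < n)%N -> C Y -> ext k X Y.
Proof.
case: Cct => -[_ _ _ H] _; rewrite H; split=> -[fX eX]; split=> //.
  by move=> k Y kn CY; apply/Ext_vanishS/eX.
by case=> // k Y kn CY; apply/Ext_vanishS/eX.
Qed.

Lemma ct_ext k X Y : ~~ (n %| k.+1)%N -> C X -> C Y -> ext k X Y.
Proof. by case: Cct => _ H nk CX CY; apply/Ext_vanishS/H. Qed.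

Lemma ct_stable_retract X' X : fingen X' -> stable_retract X' X -> C X -> C X'.
Proof.
move=> fX' XX /ct_leftE[_ eX]; apply/ct_leftE; split=> // k Y kn CY.
exact: ext_stable_retract XX (eX _ _ kn CY).
Qed.

(** Ext^i out of the syzygy is Ext^(i+n) out of X, and for 0 < i < n the degree i + n is no multiple
    of n. *)
Lemma ct_syz K X : fingen K -> syz n K X -> C X -> C K.
Proof.
move=> fK sK CX; apply/ct_leftE; split=> // k Y kn CY.
apply/(ext_syz _ _ sK); apply: ct_ext => //.
by rewrite -addSn dvdn_addl // gtnNdvd.
Qed.

Lemma fingen_syz m K X : syz m K X -> fingen X -> fingen K.
Proof.
case: m => [-> //|m [Y [P [f [g [[fP _] [fi _ _] _]]]]] _].
exact: noeS fi fP.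
Qed.

Lemma syz_split a b K X : syz (a + b) K X -> exists2 Y, syz a K Y & syz b Y X.
Proof.
elim: a K => [|a IHa] K; first by exists K.
move=> [W [P [f [g [pP fg /IHa[Y sW sY]]]]]]; exists Y => //.
by exists W, P, f, g.
Qed.

Lemma ct_syz_mul m K X : syz (m * n) K X -> C X -> C K.
Proof.
elim: m K => [|m IHm] K; first by move=> ->.
rewrite mulSn => /syz_split[Y sK sY] CX; have CY := IHm _ sY CX.
by apply: (ct_syz _ sK) => //; apply: fingen_syz sK (ct_fingen CY).
Qed.

Definition Cperp X := C X /\ perp X.

Lemma perp_projective X : perp X -> forall T l, projective T -> ext l X T.
Proof. by move=> pX T l; apply: perp_ext. Qed.

Lemma Cperp_cosyz K X : Cperp K -> syz n K X -> perp X -> Cperp X.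
Proof.
move=> [CK pK] sK pX; split=> //; apply/ct_leftE; split=> [|k Y kn CY].
  by case: pX.
have [L [sL fL]] := syz_exists noeS n (ct_fingen CY).
have CL := ct_syz fL sL CY.
apply/(ext_syz_right k (perp_projective pX) sL)/(ext_syz _ _ sK).
by apply: ct_ext => //; rewrite gtnNdvd.
Qed.

Lemma Cperp_cosyz_mul m K : Cperp K -> exists X, syz (m * n) K X /\ Cperp X.
Proof.
elim: m K => [|m IHm] K MK; first by exists K.
have [Y [sY pY]] := cosyz_exists perp_emb n MK.2.
have [X [sX MX]] := IHm _ (Cperp_cosyz MK sY pY).
by exists X; split=> //; rewrite mulSn; apply: syz_cat sY sX.
Qed.

Lemma syz_perp K X : syz (d * n) K X -> fingen X -> perp K.
Proof.
move=> sK fX; split=> [|k]; first exact: fingen_syz sK fX.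
apply/(ext_syz _ _ sK)/extS/(leq_trans (leq_pmulr d n_gt0)).
exact: leq_addl.
Qed.

Lemma right_approxE F A X (f : {linear A -> X}) : @right_approx S F X A f ->
  F A /\ right_stable_approx F f.
Proof.
move=> [FA rf]; split=> // M g FM; have [h hE] := rf M g FM; exists h.
exists 'rV[S]_0, \0, \0; split; first exact: rV_prj.
by move=> x; rewrite hE subrr.
Qed.

Lemma left_approxE F A X (f : {linear X -> A}) : @left_approx S F X A f ->
  F A /\ left_stable_approx F f.
Proof.
move=> [FA lf]; split=> // M g FM; have [h hE] := lf M g FM; exists h.
exists 'rV[S]_0, \0, \0; split; first exact: rV_prj.
by move=> x; rewrite hE subrr.
Qed.

Lemma Cperp_right_approx X : perp X ->
  exists A Z (f : {linear A -> X}) (i : {linear Z -> A}),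
    [/\ right_approx Cperp f, short_exact i f & perp Z].
Proof.
move=> pX; have [Y [sX pY]] := cosyz_exists perp_emb (d * n) pX.
have [[A [f /right_approxE[CA rf]]] _] := ct_ff Cct.1 pY.1.
have Mperp W : Cperp W -> perp W by case.
have rfM : right_stable_approx Cperp f by move=> W g [CW _]; apply: rf.
have [B [k [fB sB rk]]] :=
  right_stable_approx_syz noeS Mperp (ct_fingen CA) rfM sX.
have MB : Cperp B.
  by split; [apply: ct_syz_mul sB CA|apply: syz_perp sB (ct_fingen CA)].
have [L [P [j [q [pP jq fL]]]]] := fingen_cover_seq noeS pX.1.
(* The cover q makes t surjective, and every map to X through a projective lifts along q, which
   removes the stable error. *)
have [t tE] := linear_copair k q.
have ts : surj t.
  by move=> x; have [_ _ qs] := jq; have [y <-] := qs x; exists (0, y);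
    rewrite tE linear0 add0r.
have fBP := fingen_prod fB pP.1.
have BP := prod_stable_retract B pP.2.
have MBP : Cperp (B * P)%type.
  split; first exact: ct_stable_retract fBP BP MB.1.
  exact: perp_stable_retract fBP BP MB.2.
have [Z [i it]] := surj_short_exact ts.
exists (B * P)%type, Z, t, i; split=> //;
  last exact: (perp_kernel noeS it MBP.2 pX).
(* Each test module is itself a d * n-th syzygy of a module in [Cperp], so [rk] applies to it. *)
split=> // M g MM; have [W [sW MW]] := Cperp_cosyz_mul d MM.
have [h [T [a [b [[_ pT] E]]]]] := rk M g (ex_intro2 _ _ W MW sW).
have [_ _ qs] := jq; have [c cE] := pT _ _ q b qs.
have [r rE] := linear_pair h (c \o a : {linear _ -> _}).
by exists r => x; rewrite rE tE /= cE -E addrC subrK.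
Qed.

Lemma perp_prod_prj X P : perp X -> prj P -> perp (X * P)%type.
Proof.
move=> pX [fP pP]; have fXP := fingen_prod pX.1 fP.
exact: perp_stable_retract fXP (prod_stable_retract X pP) pX.
Qed.

(* With X -> P -> X' and A -> Q -> A' conflations, the cokernel of X -> A * P is
   realised as the kernel of X' * Q -> A', the cocone of X' -> A'. *)
Lemma perp_pushout X A (k : {linear X -> A}) : perp X -> perp A ->
  exists P (f : {linear X -> P}) L (t : {linear (A * P)%type -> L})
      (s : {linear X -> (A * P)%type}),
    [/\ prj P, forall T, projective T -> extends_along f T, short_exact s t,
        perp L & forall x, s x = (k x, f x)].
Proof.
move=> pX pA.
have [X' [P [f [g [pP fg pX']]]]] := perp_cosyzygy perp_emb pX.
have [A' [Q [i [p [pQ ip pA']]]]] := perp_cosyzygy perp_emb pA.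
have ef T : projective T -> extends_along f T.
  by move=> pT; apply: (ext0_extends fg); apply: (perp_projective pX').
have [k' [H [Hf Hg]]] := cosyzygy_map_exists fg ip k pP.2 (perp_projective pX'
  0 pQ.2).
have [fi fgE gs] := fg; have [ii ipE ps] := ip.
have [c cE] := linear_copair k' p.
have cs : surj c.
  by move=> y; have [x <-] := ps y; exists (0, x); rewrite cE linear0 add0r.
have [L [l lc]] := surj_short_exact cs; have [li lcE _] := lc.
have [h1 h1E] := linear_pair (g \o snd : {linear (A * P)%type -> X'})
  ((i \o fst) \- (H \o snd) : {linear (A * P)%type -> Q}).
have [|t tE] := short_exact_lift (h := h1) lc.
  case=> a y; rewrite h1E cE /= linearB (exact0 _ ipE) Hg sub0r subrr //.
have [s sE] := linear_pair k f.
exists P, f, L, t, s; split=> //; last first.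
  exact: (perp_kernel noeS lc (perp_prod_prj pX' pQ) pA').
split.
- by move=> x y; rewrite !sE => -[_ /fi].
- case=> a y; split=> [ty|[x]].
    have : h1 (a, y) = 0 by rewrite -tE ty linear0.
    rewrite h1E /= => -[/fgE[x xE] /eqP]; rewrite subr_eq0 => /eqP e.
    exists x; rewrite sE; apply: injective_projections => //=.
    by apply: ii; rewrite e -xE Hf.
  rewrite sE => -[<- <-]; apply: li; rewrite tE h1E /= (exact0 _ fgE) Hf subrr.
  by rewrite linear0.
- move=> z; have : c (l z) = 0 by apply: exact0 lcE.
  case E : (l z) => [x' q]; rewrite cE => e; have [y yE] := gs x'.
  have /ipE[a aE] : p (q + H y) = 0 by rewrite linearD Hg yE addrC.
  by exists (a, y); apply: li; rewrite tE h1E E /= yE aE addrK.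
Qed.

Lemma Cperp_left_approx X : perp X ->
  exists A Z (f : {linear X -> A}) (p : {linear A -> Z}),
    [/\ left_approx Cperp f, short_exact f p & perp Z].
Proof.
move=> pX; have [Y [sX pY]] := cosyz_exists perp_emb (d * n) pX.
have [_ [A [f /left_approxE[CA lf]]]] := ct_ff Cct.1 pY.1.
have Mperp W : Cperp W -> perp W by case.
have lfM : left_stable_approx Cperp f by move=> W g [CW _]; apply: lf.
have [B [k [fB sB lk]]] :=
  left_stable_approx_syz noeS pY (ct_fingen CA) lfM Mperp sX.
have MB : Cperp B.
  by split; [apply: ct_syz_mul sB CA|apply: syz_perp sB (ct_fingen CA)].
(* Dually, the embedding j of X into a projective makes s injective, and maps from X to projectives
   extend along j. *)
have [P [j [L [t [s [pP ej st pL sE]]]]]] := perp_pushout k pX MB.2.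
have MBP : Cperp (B * P)%type.
  split; last exact: perp_prod_prj MB.2 pP.
  apply: ct_stable_retract (prod_stable_retract B pP.2) MB.1.
  exact: fingen_prod fB pP.1.
exists (B * P)%type, L, s, t; split=> //.
split=> // M g MM; have [W [sW MW]] := Cperp_cosyz_mul d MM.
have [h [T [a [b [[_ pT] E]]]]] := lk M g (ex_intro2 _ _ W MW sW).
have [c cE] := ej T pT a.
have [r rE] := linear_copair h (b \o c : {linear _ -> _}).
by exists r => x; rewrite sE rE /= -cE -E addrC subrK.
Qed.

Lemma Cperp_leftE X : Cperp X <->
  perp X /\ forall k Y, (k.+1 < n)%N -> Cperp Y -> ext k X Y.
Proof.
split=> [[CX pX]|[pX eX]].
  by split=> // k Y kn [CY _]; apply: ct_ext => //; rewrite gtnNdvd.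
split=> //; apply/ct_leftE; split=> [|k Y kn CY]; first by case: pX.
(* Y and some W in [Cperp] share the d * n-th syzygy K, so Ext(X, Y) and Ext(X, W) both shift to
   Ext(X, K). *)
have [K [sK fK]] := syz_exists noeS (d * n) (ct_fingen CY).
have MK : Cperp K by split;
  [apply: ct_syz_mul sK CY|apply: syz_perp sK (ct_fingen CY)].
have [W [sW MW]] := Cperp_cosyz_mul d MK.
apply/(ext_syz_right k (perp_projective pX) sK).
by apply/(ext_syz_right k (perp_projective pX) sW)/eX.
Qed.

(* Along a left approximation X -> A -> Z with A in Cperp, vanishing of
   Ext^i(Cperp, -) is lost in one degree and vanishing of Ext^i(-, Cperp) gained in
   one; after n - 1 steps Cperp_leftE applies, and the sequences split backwards. *)
Lemma Cperp_rightE X : Cperp X <->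
  perp X /\ forall k Y, (k.+1 < n)%N -> Cperp Y -> ext k Y X.
Proof.
split=> [[CX pX]|[pX eX]].
  by split=> // k Y kn [CY _]; apply: ct_ext => //; rewrite gtnNdvd.
(* r counts the degrees where Ext([Cperp], X) vanishes, j those where Ext(X, [Cperp]) does; r + j =
   n - 1 is preserved while r drops from n - 1 to 0. *)
suff H r : forall j X, (r + j.+1 = n)%N -> perp X ->
    (forall k Y, (k < r)%N -> Cperp Y -> ext k Y X) ->
    (forall k Y, (k < j)%N -> Cperp Y -> ext k X Y) -> Cperp X.
  apply: (H n.-1 0%N) => //; first by rewrite addn1 prednK.
  by move=> k Y; rewrite -ltnS prednK // => kn; apply: eX.
elim: r => [|r IHr] {eX pX}j {}X jn pX eYX eXY.
  by apply/Cperp_leftE; split=> // k Y; rewrite -jn add0n ltnS; apply: eXY.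
have [A [Z [f [p [[MA lf] fp pZ]]]]] := Cperp_left_approx pX.
have nn k : (k.+1 < n)%N -> ~~ (n %| k.+1)%N by move=> kn; rewrite gtnNdvd.
have MZ : Cperp Z.
  apply: (IHr j.+1) => //; first by rewrite addnS.
    move=> k Y kr MY; apply: (ext_quotient fp); last exact: eYX.
    apply: ct_ext MY.1 MA.1; apply: nn; rewrite -jn addSn ltnS.
    by apply: leq_trans kr _; apply: leq_addr.
  case=> [|k] Y kj MY.
    apply: ext0_cokernel fp _ (fun u => lf Y u MY).
    by apply: ct_ext MA.1 MY.1; apply: nn; rewrite -jn addSn addnS.
  apply: ext_cokernel fp _ _; first exact: eXY.
  apply: ct_ext MA.1 MY.1; apply: nn; rewrite -jn addSn addnS !ltnS.
  by apply: leq_trans (leq_addl _ _).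
(* Ext^1(Z, X) = 0 splits the approximation, so X is a retract of A. *)
have [t tE] := ext0_extends fp (eYX 0%N Z (ltn0Sn _) MZ) idfun.
split=> //; apply: ct_stable_retract MA.1; first by case: pX.
by apply: (@retract_stable_retract _ _ _ f t) => x; rewrite -tE.
Qed.

End Main.

(** * Total acyclicity tested on segments of length n *)

Section Segments.
Variable S : pzRingType.
Hypothesis noeS : noetherian S.
Implicit Types (P : complex S) (Q X : lmodType S).

Lemma cycles_syz P k j : (forall i, prj (P i)) -> acyclic P ->
  syz k (cycles P j) (cycles P (j + k%:Z)).
Proof.
move=> pP acP; elim: k j => [|k IHk] j; first by rewrite addr0.
exists (cycles P (j + 1)), (P j), (cycles_incl P j), (to_cyc P j (j + 1)).
split=> //; first exact: cycles_seq.
by rewrite intS addrA; apply: IHk.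
Qed.

Lemma totally_acyclic_segment P a b Q : totally_acyclic P -> projective Q ->
  Hom_acyclic_segment P a b Q.
Proof.
move=> tP pQ; have [prjP acP homP] := tP.
split.
- have [i ->] : exists i, b = i + 1 by exists (b - 1); rewrite subrK.
  rewrite addrK => phi phi0 z.
  have [_ _ gs] := cycles_seq i acP; have [x <-] := gs z; exact: phi0.
- move=> j psi _ psi0.
  have [|phi phiE] := homP Q pQ j psi.
    move=> x; move: psi0; case: eqP => _ psi0; last exact: psi0.
    exact: (psi0 (to_cyc P (j - 1) j x)).
  case: eqP => [jb|_]; last by exists phi.
  have bj : b = j + 1 by rewrite jb subrK.
  rewrite {}bj; exists (phi \o cycles_incl P (j + 1) : {linear _ -> _}).
  exact: phiE.
(* Extending from Z^a to P^a is Ext^1(Z^(a+1), Q) = 0, and Z^(a+1) is perpendicular. *)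
- move=> phi.
  have eZ := perp_ext noeS 0 (perp_cycles (a + 1) tP) pQ.
  have [v vE] := eZ _ _ _ _ (prjP a).2 (cycles_seq a acP) phi.
  by exists v.
Qed.

(** Inside a segment the conditions agree. At its last term a map descends only to Z^b; the clause
    of the next segment at Z^b extends it to P^b. *)
Lemma segments_totally_acyclic n P : (0 < n)%N ->
  (forall j, prj (P j)) -> acyclic P ->
  (forall (i : int) Q, projective Q ->
     Hom_acyclic_segment P (i * n%:Z) ((i + 1) * n%:Z) Q) ->
  totally_acyclic P.
Proof.
move=> n0 prjP acP segP; split=> // Q pQ j psi psi0.
have nZ0 : n%:Z != 0 by rewrite eqz_nat -lt0n.
pose i := (j %/ n%:Z)%Z.
have jE : j = i * n%:Z + (j %% n%:Z)%Z by apply: divz_eq.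
have ij : (i * n%:Z <= j < (i + 1) * n%:Z)%R.
  rewrite {1 2}jE Num.Theory.lerDl modz_ge0 // mulrDl mul1r.
  by rewrite Num.Theory.ltrD2l ltz_pmod.
have [_ H2 _] := segP i Q pQ; have [_ _ H3] := segP (i + 1) Q pQ.
have := H2 j psi ij.
(* Z^j is the image of P^(j-1), so both forms of the premise follow from [psi0]. *)
have -> : (if j == i * n%:Z then forall z : cycles P j, psi (val z) = 0
    else forall x : P (j - 1), psi (cd P (j - 1) j x) = 0) = True.
  apply: propext; split=> // _; case: eqP => // _ z.
  have dz := lker_inclP (cd P j (j + 1)) z.
  by have /acP[x xE] := dz; rewrite -[val z]xE.
move=> /(_ Logic.I); case: eqP => // jb [phi phiE].
have bj : (i + 1) * n%:Z = j + 1 by rewrite jb subrK.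
move: phi H3 phiE; rewrite {}bj => phi H3 phiE.
have [u uE] := H3 phi; exists u => x; rewrite phiE uE //.
Qed.

End Segments.

(** * Cluster tilting in the exact and in the stable category *)

Section Stable.
Variable S : pzRingType.
Hypothesis noeS : noetherian S.
Hypothesis perp_emb : forall X : lmodType S, perp X ->
  exists n (X' : lmodType S) (f : {linear X -> 'rV[S]_n})
      (g : {linear 'rV[S]_n -> X'}), short_exact f g /\ perp X'.
Variable d : nat.
Hypothesis extS : forall k (X : lmodType S), (d <= k)%N -> ext k X S^o.
Variables (n : nat) (n_gt0 : (0 < n)%N) (C : lmodType S -> Prop).
Hypothesis Cct : nZ_cluster_tilting n C.
Implicit Types X Y Z K : lmodType S.

Lemma nZ_GprjE X : nZ_Gprj n C X <-> Cperp C X.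
Proof.
split=> [[CX [P [i [[prjP acP segP _] XP]]]]|MX].
  have tP := segments_totally_acyclic n_gt0 prjP acP segP.
  split=> //; apply/(Gprj_perp noeS perp_emb).
  by exists P, (i * n%:Z); split.
have [CX pX] := MX; split=> //.
have [P [tP XP]] := perp_complex noeS perp_emb pX.
have [prjP acP homP] := tP.
have M0 : Cperp C (cycles P 0).
  have pP := perp_cycles 0 tP; split=> //.
  by apply: (ct_stable_retract Cct pP.1) CX; apply/iso_stable_retract/iso_sym.
exists P, 0; split; last by rewrite mul0r.
split=> // [i Q pQ|i]; first exact: totally_acyclic_segment.
suff [] : Cperp C (cycles P (i * n%:Z)) by [].
have step j : syz n (cycles P (j * n%:Z)) (cycles P ((j + 1) * n%:Z)).
  by rewrite mulrDl mul1r; apply: cycles_syz.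
elim/int_rect: i => [|k IHk|k IHk]; first by rewrite mul0r.
- rewrite -addn1 PoszD; apply: (Cperp_cosyz noeS Cct IHk (step _)).
  exact: perp_cycles.
- have pP := perp_cycles (- k.+1%:Z * n%:Z) tP; split=> //.
  apply: (ct_syz Cct pP.1 (step _)); rewrite -addn1 PoszD opprD subrK.
  by case: IHk.
Qed.

Lemma nZ_Gprj_cluster_tilting : nZ_cluster_tilting_Gprj n (nZ_Gprj n C).
Proof.
have -> : nZ_Gprj n C = Cperp C by apply: funext => X; apply/propext/nZ_GprjE.
have GE X : Gprj X <-> perp X := Gprj_perp noeS perp_emb X.
split; last first.
  by case=> // k X Y _ nk [CX _] [CY _]; apply/Ext_vanishS/(ct_ext Cct nk).
split.
- by move=> X [_ /GE].
- move=> X /GE pX.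
  have [A [Z [f [p [lf fp pZ]]]]] :=
    Cperp_left_approx noeS perp_emb extS n_gt0 Cct pX.
  exists A, f; split=> //; split; [exact/GE|by apply/GE; case: lf => -[]|].
  by exists Z, p; split=> //; apply/GE.
- move=> X /GE pX.
  have [A [Z [f [i [rf fi pZ]]]]] :=
    Cperp_right_approx noeS perp_emb extS n_gt0 Cct pX.
  exists A, f; split=> //; split; [by apply/GE; case: rf => -[]|exact/GE|].
  by exists Z, i; split=> //; apply/GE.
- move=> X; rewrite (Cperp_rightE noeS perp_emb extS n_gt0 Cct) GE.
  split=> -[pX eX]; split=> //; last by move=> k Y kn MY; apply/Ext_vanishS/eX.
  by case=> // k Y kn MY; apply/Ext_vanishS/eX.
- move=> X; rewrite (Cperp_leftE noeS perp_emb extS n_gt0 Cct) GE.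
  split=> -[pX eX]; split=> //; last by move=> k Y kn MY; apply/Ext_vanishS/eX.
  by case=> // k Y kn MY; apply/Ext_vanishS/eX.
Qed.

Lemma conflation_syz (X Y : Gprj_ob S) : Gprj_conflation_prj X Y -> syz 1 X Y.
Proof. by move=> [P [f [g [pP fg]]]]; exists Y, P, f, g. Qed.

Lemma Sigma_syz k (X : Gprj_ob S) : syz k X (iter k (@Sigma S) X).
Proof.
elim: k => // k IHk; rewrite -addn1; apply: syz_cat IHk _; rewrite addn1 /=.
exact: conflation_syz (svalP (cid (exists_suspension _))).
Qed.

Lemma Omega_syz k (X : Gprj_ob S) : syz k (iter k (@Omega S) X) X.
Proof.
elim: k => // k IHk; apply: (@syz_cat _ 1 k) IHk.
exact: conflation_syz (svalP (cid (exists_syzygy _))).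
Qed.

(** After k + 1 syzygies of both arguments the suspension returns to Y, and stable maps from the
    (k+1)-st syzygy of X are Ext^1 out of the k-th. *)
Lemma stable_Hom_Sigma k X (Y : Gprj_ob S) : perp X ->
  stable_Hom_vanish X (Sigma_pow k.+1 Y) <-> ext k X Y.
Proof.
move=> pX; have [K [sK fK]] := syz_exists noeS k.+1 pX.1.
rewrite (stable_Hom_vanish_syz noeS pX sK (Sigma_syz k.+1 Y)).
have [Z [P [f [g [pP fg sZ]]]]] := sK.
rewrite -[k]add0n (ext_syz _ _ sZ); apply: stable_Hom_vanish_ext fg pP _.
by move=> T; apply: (perp_projective noeS (perp_syz noeS sZ pX)).
Qed.

(* Taking k(n - 1) more syzygies of both arguments turns the second one into the
   kn-th syzygy of Y, which lies in C. *)
Lemma stable_Hom_Omega k X (Y : Gprj_ob S) : ~~ (n %| k)%N ->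
  Cperp C X -> Cperp C Y -> stable_Hom_vanish X (iter k (@Omega S) Y).
Proof.
move=> nk [CX pX] [CY pY]; set Z := iter k _ Y.
have pZ : perp Z by apply/(Gprj_perp noeS perp_emb); apply: Gprj_modP.
have n1 : (1 < n)%N by case: n n_gt0 nk => [|[|]] //; rewrite dvd1n.
have k0 : (0 < k)%N by case: (k) nk; rewrite ?dvdn0.
pose r := (k * n.-1)%N.
have rk : (r + k = k * n)%N by rewrite /r -{2}[k]muln1 -mulnDr addn1 prednK.
have [L [sL fL]] := syz_exists noeS r pZ.1.
have CL : C L.
  have sLY : syz (k * n) L Y by rewrite -rk; apply: syz_cat sL (Omega_syz k Y).
  exact: (ct_syz_mul noeS Cct sLY CY).
have [K [sK fK]] := syz_exists noeS r pX.1.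
rewrite (stable_Hom_vanish_syz noeS pX sK sL).
(* Since r > 0, stable maps from the r-th syzygy of X to L are Ext^r(X, L); and r is congruent to -k
   modulo n, hence no multiple of n. *)
have : (0 < r)%N by rewrite muln_gt0 k0 -ltnS prednK.
have : ~~ (n %| r)%N.
  by apply: contra nk => nr; rewrite -(dvdn_addr k nr) rk dvdn_mull.
case: r sK {sL rk} => // s [W [P [f [g [pP fg sW]]]]] ns _.
apply/(stable_Hom_vanish_ext L fg pP).
  by move=> T; apply: (perp_projective noeS (perp_syz noeS sW pX)).
by apply/(ext_syz 0 _ sW); apply: (ct_ext Cct ns).
Qed.

Lemma stable_nZ_Gprj_cluster_tilting :
  nZ_cluster_tilting_stable n (stable_nZ_Gprj n C).
Proof.
have ME (X : Gprj_ob S) : stable_nZ_Gprj n C X <-> Cperp C X := nZ_GprjE X.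
have GE X : Gprj X <-> perp X := Gprj_perp noeS perp_emb X.
have pG (X : Gprj_ob S) : perp X by apply/GE/Gprj_modP.
have zero (X Y : Gprj_ob S) (h k : X -> Y) : (forall x, h x = k x) ->
  stable_eq h k.
  move=> hk; exists 'rV[S]_0, \0, \0; split; first exact: rV_prj.
  by move=> x; rewrite hk subrr.
have lift X (MX : Cperp C X) : exists Y : Gprj_ob S, Gprj_mod Y = X.
  by exists (GprjOb ((GE X).2 MX.2)).
split; last first.
  case=> k X Y nk /ME MX /ME MY.
    case: k nk => [|k] nk; first by rewrite dvdz0 in nk.
    apply/stable_Hom_Sigma; first exact: pG.
    by apply: (ct_ext Cct _ MX.1 MY.1).
  by apply: stable_Hom_Omega.
split.
- move=> X; split.
    have [A [Z [f [i [[MA rf] _ _]]]]] :=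
      Cperp_right_approx noeS perp_emb extS n_gt0 Cct (pG X).
    have [Y YA] := lift A MA; move: f {i} MA rf; rewrite -YA => f MA rf.
    exists Y, f; split=> [|U g /ME MU]; first exact/ME.
    by have [h hE] := rf U g MU; exists h; apply: zero.
  have [A [Z [f [i [[MA lf] _ _]]]]] :=
    Cperp_left_approx noeS perp_emb extS n_gt0 Cct (pG X).
  have [Y YA] := lift A MA; move: f {i} MA lf; rewrite -YA => f MA lf.
  exists Y, f; split=> [|U g /ME MU]; first exact/ME.
  by have [h hE] := lf U g MU; exists h; apply: zero.
- move=> X; rewrite ME (Cperp_rightE noeS perp_emb extS n_gt0 Cct).
  split=> [[pX eX] [[|k]|k] // Y kn /ME MY|H].
    by apply/stable_Hom_Sigma; [apply: pG|apply: eX].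
  split=> // k Y kn MY; have [U UY] := lift Y MY; subst Y.
  by apply/stable_Hom_Sigma; [apply: pG|apply: H => //; apply/ME].
- move=> X; rewrite ME (Cperp_leftE noeS perp_emb extS n_gt0 Cct).
  split=> [[pX eX] [[|k]|k] // Y kn /ME MY|H].
    by apply/stable_Hom_Sigma; [apply: pG|apply: eX].
  split=> // k Y kn MY; have [U UY] := lift Y MY; subst Y.
  by apply/stable_Hom_Sigma; [apply: pG|apply: H => //; apply/ME].
Qed.

End Stable.

(** * Artin algebras are noetherian on both sides *)

Section ArtinAlgebra.
Variables (R : comPzRingType) (A : algType R).
Hypothesis artA : artin_algebra A.

Lemma artin_algebra_noetherian : noetherian (A : pzRingType).
Proof.
have [artR [k [e eP]]] := artA.
apply: (@artinian_noetherian R A (in_alg A)) => //.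
exists k, e => x; have [c cE] := eP x; exists c; rewrite [LHS]cE.
by apply: eq_bigr => i _; rewrite -mulr_algl.
Qed.

(** As R is commutative, the structure map is multiplicative for the reversed product too, so right
    modules also restrict to R. *)
Definition in_alg_op (r : R) : (A : pzRingType)^c := r%:A.

Lemma in_alg_op_zmod : zmod_morphism in_alg_op.
Proof. by move=> x y; apply: (raddfB (in_alg A)). Qed.

Lemma in_alg_op_monoid : monoid_morphism in_alg_op.
Proof.
split=> [|x y]; first exact: (rmorph1 (in_alg A)).
by rewrite /in_alg_op mulrC; apply: (rmorphM (in_alg A)).
Qed.

HB.instance Definition _ :=
  GRing.isZmodMorphism.Build R ((A : pzRingType)^c) in_alg_op in_alg_op_zmod.
HB.instance Definition _ :=
  GRing.isMonoidMorphism.Build R ((A : pzRingType)^c)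
    in_alg_op in_alg_op_monoid.

Lemma artin_algebra_noetherian_op : noetherian (A : pzRingType)^c.
Proof.
have [artR [k [e eP]]] := artA.
apply: (@artinian_noetherian R _ in_alg_op) => //.
exists k, e => x; have [c cE] := eP x; exists c; rewrite [LHS]cE.
by apply: eq_bigr => i _; rewrite -[c i *: e i]mulr_algr.
Qed.

End ArtinAlgebra.

Theorem theorem1 (n : nat) (n_gt0 : (0 < n)%N) (R : comPzRingType)
    (Lambda : algType R) (artin_Lambda : artin_algebra Lambda)
    (IG_Lambda : Iwanaga_Gorenstein Lambda)
    (C : lmodType (Lambda : pzRingType)^c -> Prop)
    (C_nZct : nZ_cluster_tilting n C) :
  nZ_cluster_tilting_Gprj n (nZ_Gprj n C) /\
  nZ_cluster_tilting_stable n (stable_nZ_Gprj n C).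
Proof.
have noeL := artin_algebra_noetherian artin_Lambda.
have noeS := artin_algebra_noetherian_op artin_Lambda.
have [injS injL] := IG_Lambda.
have emb := @perp_embedding _ noeS noeL injL.
have [d extS] := finite_injdim_ext injS.
split; first exact: (nZ_Gprj_cluster_tilting noeS emb extS n_gt0 C_nZct).
exact: (stable_nZ_Gprj_cluster_tilting noeS emb extS n_gt0 C_nZct).
Qed.
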